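(* Let $d\ge 2$, let $P$ be a Borel probability measure on $\mathbb{R}^d$, let $G$ be a finite multiplicative group of $d\times d$ real orthogonal matrices generated by $k$ elements $T_1,\dots,T_k$, and let $0<\alpha<1/k$. Assume that: (i) the absolute moments $m_N:=\int\|x\|^N\,dP(x)$ are finite for all $N\ge 1$ and satisfy $\sum_{N\ge 1} m_N^{-1/N}=\infty$; (ii) $P$ is absolutely continuous with respect to Lebesgue measure on $\mathbb{R}^d$. Consider the null hypothesis $H_0$: $PT^{-1}=P$ for all $T\in G$, and the random-projection Kolmogorov--Smirnov test of $H_0$ described in the context. Then: (a) if $H_0$ holds, the probability that the test rejects $H_0$ lies between $\alpha/k$ and $\alpha$; (b) the test is consistent under the alternative: if $H_0$ fails, then the probability that the test rejects $H_0$ tends to $1$ as $n_1,n_2\to\infty$.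
   Context: For a linear map $T:\mathbb{R}^d\to\mathbb{R}^d$, $PT^{-1}$ denotes the push-forward measure $PT^{-1}(B):=P(T^{-1}(B))$ for Borel $B\subset\mathbb{R}^d$. The norm $\|\cdot\|$ and inner product $\langle\cdot,\cdot\rangle$ are Euclidean. The test. An i.i.d. sample of size $n=n_1+n_2$ with common distribution $P$ is split at random into two disjoint subsamples $\mathbf{X}_1,\dots,\mathbf{X}_{n_1}$ and $\mathbf{X}'_1,\dots,\mathbf{X}'_{n_2}$ (so these are two independent i.i.d. samples from $P$, of sizes $n_1$ and $n_2$). Independently of the sample, generate independent random directions $h_1,\dots,h_k$, each uniformly distributed on the unit sphere of $\mathbb{R}^d$. For a unit vector $h$ and $T\in G$, define the two-sample Kolmogorov--Smirnov statistic $$KS(n_1,n_2,h,T):=\sup_{t\in\mathbb{R}}\Bigl|\frac{1}{n_1}\#\{i\le n_1:\langle h,\mathbf{X}_i\rangle\le t\}-\frac{1}{n_2}\#\{i\le n_2:\langle h,T(\mathbf{X}'_i)\rangle\le t\}\Bigr|.$$ The critical value $c_{\alpha/k}=c_{\alpha/k,n_1,n_2}$ is chosen so that, under $H_0$, $\Pr\bigl(KS(n_1,n_2,h_j,T_j)>c_{\alpha/k}\bigr)=\alpha/k$ for each $j=1,\dots,k$. That is, $c_{\alpha/k,n_1,n_2}$ is the level-$\alpha/k$ critical value of the classical two-sample Kolmogorov--Smirnov statistic for two independent samples of sizes $n_1$ and $n_2$ drawn from a common continuous distribution on $\mathbb{R}$; it does not depend on $j$ or on $P$. It is assumed that critical values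 with exactly this property are used for all the sample sizes $(n_1,n_2)$ under consideration. The test rejects $H_0$ if $KS(n_1,n_2,h_j,T_j)>c_{\alpha/k}$ for at least one $j\in\{1,\dots,k\}$. *)

(* Defs.v *)
From HB Require Import structures.
From mathcomp Require Import all_boot all_order all_algebra.
From mathcomp Require Import all_classical all_reals all_analysis measurable_realfun.
Import Order.TTheory GRing.Theory Num.Theory.
Import numFieldNormedType.Exports.

Set Implicit Arguments.
Unset Strict Implicit.
Unset Printing Implicit Defensive.

Local Open Scope classical_set_scope.
Local Open Scope ring_scope.

(* Column vectors with the Borel sigma-algebra; the topology of 'cV[R]_d is
   the product topology, hence the Euclidean one. *)
Notation borelRd R d := (g_sigma_algebraType (@open 'cV[R]_d)).

Section euclidean.
Context {R : realType} {d : nat}.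
Implicit Types (x y : 'cV[R]_d) (A : set 'M[R]_d).

Definition inner x y : R := \sum_(i < d) x i 0 * y i 0.

(* The library's `|x| on 'cV[R]_d is the sup norm. *)
Definition enorm x : R := Num.sqrt (inner x x).

Definition orthogonal_mx (M : 'M[R]_d) : Prop := M *m M^T = 1%:M.

Definition mx_group A : Prop :=
  [/\ A `<=` [set M | M \in unitmx],
      A 1%:M,
      forall M N, A M -> A N -> A (M *m N) &
      forall M, A M -> A (invmx M)].

Definition mx_generated k (T : 'I_k -> 'M[R]_d) : set 'M[R]_d :=
  smallest mx_group (range T).

End euclidean.

(* Lebesgue measure of a Borel set of R^d, as the d-fold product of the
   one-dimensional Lebesgue measure: as in the library's binary product
   measure, the one-dimensional measure integrates the measures of the
   sections. *)
Fixpoint lebesgueRd (R : realType) (d : nat) : set (borelRd R d) -> \bar R :=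
  match d with
  | 0 => fun A => (\1_A (0 : 'cV[R]_0))%:E
  | d'.+1 => fun A => (\int[@lebesgue_measure R]_t
      lebesgueRd [set x : 'cV[R]_d' | A (col_mx (t%:M : 'M[R]_1) x)])%E
  end.

Lemma lebesgueRd_set0 (R : realType) (d : nat) :
  lebesgueRd (set0 : set (borelRd R d)) = 0%E.
Proof.
elim: d => [|d IH] /=; first by rewrite indicE in_set0.
by under eq_integral do rewrite IH; rewrite integral0.
Qed.

Lemma lebesgueRd_box (R : realType) (d : nat) (a b : 'I_d -> R) :
  (forall i, a i <= b i) ->
  lebesgueRd [set x : 'cV[R]_d | forall i, a i <= x i 0 <= b i] =
  (\prod_(i < d) (b i - a i))%:E.
Proof.
elim: d a b => [a b _|d IH a b ab].
  by rewrite big_ord0 /= indicE mem_set// => -[].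
have e0 : ord0 = lshift d (ord0 : 'I_1) :> 'I_d.+1 by apply: ord_inj.
have eS j : lift ord0 j = rshift 1 j :> 'I_d.+1 by apply: ord_inj.
have c0 (t : R) (x : 'cV_d) : (col_mx (t%:M : 'M[R]_1) x : 'cV_d.+1) ord0 0 = t.
  by rewrite e0 (col_mxEu (t%:M : 'M[R]_1) x ord0 0) mxE mulr1n.
have cS (t : R) (x : 'cV_d) j :
    (col_mx (t%:M : 'M[R]_1) x : 'cV_d.+1) (lift ord0 j) 0 = x j 0.
  by rewrite eS (col_mxEd (t%:M : 'M[R]_1) x j 0).
rewrite /= big_ord_recl mulrC EFinM.
under eq_integral => t _.
  rewrite (_ : lebesgueRd _ =
    ((\prod_(i < d) (b (lift ord0 i) - a (lift ord0 i)))%:E *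
     (\1_`[a ord0, b ord0] t)%:E)%E); first over.
  rewrite indicE; have [|] := boolP (t \in _).
    rewrite inE/= in_itv/= => tab; rewrite mule1 -IH//; congr lebesgueRd.
    apply/seteqP; split => x /= hx i; first by rewrite -(cS t) hx.
    by case: (unliftP ord0 i) => [j ->|->]; rewrite ?cS ?c0.
  rewrite notin_setE/= in_itv/= => tab; rewrite mule0 -(lebesgueRd_set0 R d).
  congr lebesgueRd; apply/seteqP; split => x //= /(_ ord0).
  by rewrite c0.
rewrite ge0_integralZl//; last 2 first.
- exact/measurable_EFinP.
- by rewrite lee_fin; apply: prodr_ge0 => i _; rewrite subr_ge0.
rewrite integral_indic// setIT.
rewrite [X in (_ * X)%E](lebesgue_measure_itv `[a ord0, b ord0])/= lte_fin.
case: ltP => [_|h]; first by rewrite -EFinB.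
by rewrite (_ : b ord0 = a ord0) ?subrr//; apply/le_anti; rewrite h ab.
Qed.

Section probability_on_Rd.
Context {R : realType} {d : nat}.
Local Open Scope ereal_scope.

(* Normalized surface measure through polar coordinates: the surface measure
   of A is proportional to the volume of {r a | a in A, 0 < r <= 1}. *)
Definition unit_cone (A : set 'cV[R]_d) : set 'cV[R]_d :=
  [set x | (0 < enorm x <= 1)%R /\ A ((enorm x)^-1 *: x)%R].

Definition uniform_sphere (A : set (borelRd R d)) : \bar R :=
  (fine (lebesgueRd (unit_cone A)) / fine (lebesgueRd (unit_cone setT)))%:E.

Definition abs_moment (P : probability (borelRd R d) R) (N : nat) : \bar R :=
  \int[P]_x (enorm x ^+ N)%:E.

Definition invariant_under (P : probability (borelRd R d) R)
    (G : set 'M[R]_d) : Prop :=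
  forall T, G T -> forall B : set (borelRd R d), measurable B ->
    pushforward P (mulmx T : borelRd R d -> borelRd R d) B = P B.

End probability_on_Rd.

Definition mutually_independent (disp dV : measure_display)
    (Omega : measurableType disp) (V : measurableType dV) (R : realType)
    (Pr : probability Omega R) (I : finType) (Y : I -> {RV Pr >-> V}) : Prop :=
  forall A : I -> set V, (forall i, measurable (A i)) ->
    Pr (\bigcap_(i in [set: I]) (Y i @^-1` A i)) =
    (\prod_(i : I) Pr (Y i @^-1` A i))%E.

Definition join_families (I J V : Type) (x : I -> V) (y : J -> V) (s : I + J) : V :=
  match s with inl i => x i | inr j => y j end.

Section kolmogorov_smirnov.
Context {R : realType}.

Definition ecdf (n : nat) (y : 'I_n -> R) (t : R) : R :=
  #|[pred i | y i <= t]|%:R / n%:R.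

Definition two_sample_KS (n1 n2 : nat) (y : 'I_n1 -> R) (z : 'I_n2 -> R) : R :=
  sup [set `|ecdf y t - ecdf z t| | t in [set: R]].

Definition projected_KS (d n1 n2 : nat) (h : 'cV[R]_d) (T : 'M[R]_d)
    (x : 'I_n1 -> 'cV[R]_d) (x' : 'I_n2 -> 'cV[R]_d) : R :=
  two_sample_KS (fun i => inner h (x i)) (fun i => inner h (T *m x' i)).

(* [c] is the level-[a] critical value of the classical two-sample test; for
   given sample sizes the statistic is discrete, so that [c] exists for some
   levels only. *)
Definition KS_critical_value (a : R) (n1 n2 : nat) (c : R) : Prop :=
  forall (disp : measure_display) (Omega : measurableType disp)
    (Pr : probability Omega R) (Q : probability R R)
    (Y : 'I_n1 -> {RV Pr >-> R}) (Z : 'I_n2 -> {RV Pr >-> R}),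
    continuous (fun t : R => Q `]-oo, t]%classic) ->
    (forall i B, measurable B -> distribution Pr (Y i) B = Q B) ->
    (forall i B, measurable B -> distribution Pr (Z i) B = Q B) ->
    mutually_independent (join_families Y Z) ->
    Pr [set w | c < two_sample_KS (Y ^~ w) (Z ^~ w)] = a%:E.

(* Two samples from [P], and uniform random directions, all independent. *)
Definition KS_experiment (d k n1 n2 : nat) (P : probability (borelRd R d) R)
    (disp : measure_display) (Omega : measurableType disp)
    (Pr : probability Omega R)
    (X : 'I_n1 -> {RV Pr >-> borelRd R d})
    (X' : 'I_n2 -> {RV Pr >-> borelRd R d})
    (h : 'I_k -> {RV Pr >-> borelRd R d}) : Prop :=
  [/\ forall i B, measurable B -> distribution Pr (X i) B = P B,
      forall i B, measurable B -> distribution Pr (X' i) B = P B,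
      forall j B, measurable B -> distribution Pr (h j) B = uniform_sphere B &
      mutually_independent (join_families (join_families X X') h)].

Definition KS_rejection (d k n1 n2 : nat) (T : 'I_k -> 'M[R]_d) (c : R)
    (Omega : Type) (X : 'I_n1 -> Omega -> 'cV[R]_d)
    (X' : 'I_n2 -> Omega -> 'cV[R]_d) (h : 'I_k -> Omega -> 'cV[R]_d) :
    set Omega :=
  [set w | exists j, c < projected_KS (h j w) (T j) (X ^~ w) (X' ^~ w)].

End kolmogorov_smirnov.

(* Main.v *)
(** Level: for a fixed direction [h <> 0] the projections of the two samples are
    i.i.d. with a continuous distribution function, since hyperplanes are null for
    an absolutely continuous law.  As the directions are independent of the
    samples, Fubini integrates the exact level alpha/k over the random direction;
    the bounds alpha/k and alpha are monotonicity and the union bound.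

    Consistency: if H0 fails, then Q := P T^-1 differs from P for a generator T.
    The map h |-> int <h,x>^N dP - int <h,x>^N dQ is a polynomial, and it vanishes
    at every h along which P and Q have the same projection.  If it were zero for
    all N, then each function t |-> int cos(t <h,x> + c) d(P - Q) would have all
    its derivatives zero at 0; these are dominated by the moments m_N, so Carleman's
    condition makes the function vanish (Denjoy-Carleman, by Bang's induction), and
    P = Q since trigonometric polynomials determine a probability.  Hence for almost
    every direction the two projections differ, the empirical distribution functions
    detect it by Chebyshev, and the critical values tend to 0 because the null
    statistic does (Glivenko-Cantelli on a finite grid of quantiles). *)

Require Import Defs.
From HB Require Import structures.
From mathcomp Require Import all_boot all_order all_algebra.
From mathcomp Require Import all_classical all_reals all_analysis.
From mathcomp Require Import measurable_realfun ring lra.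
Import Order.TTheory GRing.Theory Num.Theory.
Import numFieldNormedType.Exports.

Set Implicit Arguments.
Unset Strict Implicit.
Unset Printing Implicit Defensive.

Local Open Scope classical_set_scope.
Local Open Scope ring_scope.

(** * Carleman's inequality and Bang's quasi-analyticity argument *)

(** Orthogonality of T gives Q the same absolute moments as P, so Carleman's condition on P alone
    controls the difference of the two laws. Everything is read along lines: Bang's argument uses
    Taylor bounds in one real variable, obtained by integrating those of the cosine instead of
    differentiating under the integral sign, and polynomials in h are known only through their
    restrictions to lines [a + t *: v]. A single generator suffices because the matrices that
    preserve P form a group. Two obstacles shape the probabilistic part. A critical value is
    specified only through experiments that carry null samples; when H0 fails, these are found
    inside the given experiment, by projecting both untransported samples on one fixed direction,
    and the bound on the critical value then serves all directions. The sample space is abstract, so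
    Fubini cannot rely on a product structure: the sigma-algebra generated by the samples takes the
    place of the second factor. *)

(** Polya's weights: AM-GM is applied to [c i * a i]. The product of the first n+1 weights
    telescopes to (n+2)^(n+1), whose root is the factor n+2 of the denominator; the factor n+1 is
    that of the arithmetic mean. *)
Lemma geometric_mean_le (R : realType) (a : nat -> R) (n : nat) :
  (forall i, 0 <= a i) ->
  (\prod_(i < n.+1) a i) `^ n.+1%:R^-1 <=
  (\sum_(i < n.+1) (i.+2%:R ^+ i.+1 / i.+1%:R ^+ i) * a i) /
    (n.+1%:R * n.+2%:R).
Proof.
move=> a0.
pose c (i : nat) : R := i.+2%:R ^+ i.+1 / i.+1%:R ^+ i.
have c0 i : 0 <= c i by rewrite divr_ge0 ?exprn_ge0.
have prodc m : \prod_(i < m) c i = m.+1%:R ^+ m.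
  elim: m => [|m IH]; first by rewrite big_ord0 expr0.
  by rewrite big_ord_recr/= IH /c mulrCA divff ?mulr1// expf_neq0.
have s0 : 0 <= \sum_(i < n.+1) c i * a i by apply: sumr_ge0 => i _; rewrite mulr_ge0.
have E0 : {in 'I_n.+1, forall i : 'I_n.+1, 0 <= c i * a i}.
  by move=> i _; rewrite mulr_ge0.
have [+ _] := leif_AGM E0.
rewrite card_ord big_split/= prodc => h.
have h2 : \prod_(i < n.+1) a i <=
    ((\sum_(i < n.+1) c i * a i) / (n.+1%:R * n.+2%:R)) ^+ n.+1.
  rewrite invfM [_^-1 * _]mulrC mulrA mulrAC exprMn [X in _ <= _ * X]exprVn.
  rewrite ler_pdivlMr ?exprn_gt0 ?ltr0n// mulrC.
  exact: h.
have p0 : 0 <= \prod_(i < n.+1) a i by exact: prodr_ge0.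
apply: (le_trans (ge0_ler_powR _ _ _ h2)); rewrite ?nnegrE ?exprn_ge0 ?divr_ge0//.
rewrite -powR_mulrn ?divr_ge0// -powRrM divff ?powRr1 ?divr_ge0// pnatr_eq0//.
Qed.

(* The weights telescope: sum_(n >= i) 1/((n+1)(n+2)) = 1/(i+1). *)
Lemma carleman_inequality (R : realType) (a : nat -> R) (N : nat) :
  (forall i, 0 <= a i) ->
  \sum_(n < N) (\prod_(i < n.+1) a i) `^ n.+1%:R^-1 <=
  expR 1 * \sum_(i < N) a i.
Proof.
move=> a0.
pose c (i : nat) : R := i.+2%:R ^+ i.+1 / i.+1%:R ^+ i.
have c0 i : 0 <= c i by rewrite divr_ge0 ?exprn_ge0.
(* The subtracted 1/(N+1) is the part of the telescoping sum beyond N; keeping it makes the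
   induction on N exact. *)
apply: (@le_trans _ _ (\sum_(i < N) c i * a i * (i.+1%:R^-1 - N.+1%:R^-1))).
  elim: N => [|N IH]; first by rewrite !big_ord0.
  rewrite big_ord_recr/=; apply: (le_trans (lerD IH (geometric_mean_le N a0))).
  rewrite [X in X + _](_ : _ =
      \sum_(i < N.+1) c i * a i * (i.+1%:R^-1 - N.+1%:R^-1)); last first.
    by rewrite big_ord_recr/= subrr mulr0 addr0.
  rewrite mulr_suml -big_split/=; apply: ler_sum => i _.
  rewrite -/(c i) -mulrDr ler_wpM2l ?mulr_ge0// le_eqVlt; apply/orP; left; apply/eqP.
  have -> : (N.+1%:R * N.+2%:R)^-1 = N.+1%:R^-1 - N.+2%:R^-1 :> R.
    rewrite -[N.+2%:R]natr1; have : 0 < N.+1%:R :> R by rewrite ltr0n.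
    move: (N.+1%:R : R) => x x0; field.
    by rewrite !gt_eqF// addr_gt0.
  by rewrite addrA subrK.
rewrite mulr_sumr; apply: ler_sum => i _.
apply: (@le_trans _ _ (c i * a i * i.+1%:R^-1)).
  by rewrite ler_wpM2l ?mulr_ge0// gerBl invr_ge0.
rewrite mulrAC ler_wpM2r//.
have -> : c i / i.+1%:R = (1 + i.+1%:R^-1) ^+ i.+1.
  rewrite /c -mulrA -invfM -exprSr -expr_div_n; congr (_ ^+ _).
  by rewrite -[i.+2%:R]natr1 mulrDl divff ?pnatr_eq0// mul1r.
apply: (@le_trans _ _ (expR (i.+1%:R^-1) ^+ i.+1)).
  by rewrite lerXn2r ?nnegrE ?expR_ge0 ?addr_ge0 ?invr_ge0// expR_ge1Dx.
by rewrite -expRM_natl mulfV ?pnatr_eq0.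
Qed.

(** For a_i = m_i / m_(i+1) the partial products telescope to 1 / m_(n+1), so the geometric means in
    Carleman's inequality are the terms of the given divergent sum. *)
Lemma carleman_ratio_diverges (R : realType) (m : nat -> R) :
  (forall n, 0 < m n) -> m 0%N = 1 ->
  (forall A : R, exists N, A <= \sum_(n < N) m n.+1 `^ (- n.+1%:R^-1)) ->
  forall A : R, exists N, A <= \sum_(n < N) m n / m n.+1.
Proof.
move=> m0 m1 dv A; have [N hN] := dv (expR 1 * A); exists N.
have e0 : 0 < expR 1 :> R by exact: expR_gt0.
rewrite -(ler_pM2l e0); apply: (le_trans hN).
pose a i := m i / m i.+1.
have a0 i : 0 <= a i by rewrite divr_ge0// ltW.
apply: le_trans (carleman_inequality N a0).
apply: ler_sum => n _.
rewrite /a (_ : \prod_(i < n.+1) (m i / m i.+1) = (m n.+1)^-1).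
  by rewrite -[(m n.+1)^-1]powR_inv1 ?(ltW (m0 _))// -powRrM mulN1r.
elim: (nat_of_ord n) => [|k IH]; first by rewrite big_ord_recr big_ord0 /= m1 !mul1r.
by rewrite big_ord_recr/= IH mulrA mulVf ?gt_eqF// mul1r.
Qed.

(** * Taylor bounds for the cosine, and the propagation of levels *)

Lemma abs_le_of_derive (R : realType) (g g' : R -> R) (m : nat) (v : R) :
  0 <= v -> g 0 = 0 -> (forall x : R, is_derive x 1 g (g' x)) ->
  (forall x, 0 <= x -> `|g' x| <= x ^+ m / m`!%:R) ->
  `|g v| <= v ^+ m.+1 / m.+1`!%:R.
Proof.
move=> v0 g0 dg g'le.
have dB (x : R) : is_derive x 1 (fun x : R => x ^+ m.+1 / m.+1`!%:R) (x ^+ m / m`!%:R).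
  have -> : (fun x : R => x ^+ m.+1 / m.+1`!%:R) =
      (m.+1`!%:R^-1 : R) \*: (@id R ^+ m.+1).
    by apply/funext => y; rewrite /= fctE mulrC.
  apply: is_derive_eq.
  by rewrite /GRing.scale/= mulr1 factS natrM invfM mulrACA mulVf ?pnatr_eq0//
    mul1r mulrC.
have key (h h' : R -> R) : h 0 = 0 -> (forall x : R, is_derive x 1 h (h' x)) ->
    (forall x, 0 <= x -> 0 <= h' x) -> 0 <= h v.
  move=> h0 dh h'0; rewrite -h0.
  apply: (@ger0_derive1_ndecr _ h 0 v) => //.
  - by move=> x xv; rewrite derive1E derive_val; apply: h'0; move: xv; rewrite in_itv/=
      => /andP[/ltW].
  - apply/continuous_subspaceT => x; apply: differentiable_continuous.
    by apply/derivable1_diffP.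
rewrite ler_norml; apply/andP; split.
  rewrite -subr_ge0 opprK.
  apply: (key (g + (fun x : R => x ^+ m.+1 / m.+1`!%:R)) (g' \+ (fun x :
    R => x ^+ m / m`!%:R))).
  - by rewrite fctE /= g0 expr0n/= mul0r addr0.
  - by move=> x x0 /=; move: (g'le x x0); rewrite ler_norml -lerBlDr sub0r => /andP[].
rewrite -subr_ge0.
apply: (key ((fun x : R => x ^+ m.+1 / m.+1`!%:R) - g) ((fun x :
  R => x ^+ m / m`!%:R) \- g')).
- by change (0 ^+ m.+1 / m.+1`!%:R - g 0 = 0); rewrite g0 expr0n/= mul0r subr0.
- by move=> x x0 /=; move: (g'le x x0); rewrite ler_norml subr_ge0 => /andP[].
Qed.

(** Differentiating the cosine shifts its phase by pi/2, so the derivative in v of the remainder of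
    order m+1 at u is the remainder of order m at u + pi/2. The induction therefore has to range
    over all u. *)
Lemma cosD_taylor_ge0 (R : realType) (m : nat) (u v : R) : 0 <= v ->
  `|cos (u + v) - \sum_(j < m) cos (u + j%:R * (pi / 2)) * (v ^+ j / j`!%:R)| <=
  v ^+ m / m`!%:R.
Proof.
elim: m u v => [|m IH] u v v0.
  by rewrite big_ord0 subr0 expr0 divr1 ler_norml cos_geN1 cos_le1.
pose g v : R := cos (u + v) - \sum_(j < m.+1) cos (u + j%:R * (pi / 2)) * (v ^+ j /
  j`!%:R).
pose g' v : R := cos (u + pi / 2 + v) -
  \sum_(j < m) cos (u + pi / 2 + j%:R * (pi / 2)) * (v ^+ j / j`!%:R).
apply: (@abs_le_of_derive _ g g') => //.
- rewrite /g big_ord_recl/= big1 ?addr0.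
    by rewrite mul0r addr0 expr0 divr1 mulr1 subrr.
  by move=> i _; rewrite expr0n/= mul0r mulr0.
- move=> x.
  have -> : g = (@cos R \o +%R u) - \sum_(j < m.+1)
      ((cos (u + j%:R * (pi / 2)) / j`!%:R) \*: (@id R ^+ j)).
    apply/funext => y; rewrite /g /= fct_sumE; congr (_ - _).
    by apply: eq_bigr => j _; rewrite /= fctE /GRing.scale/= mulrAC mulrA.
  have -> : g' x = - sin (u + x) - \sum_(j < m.+1)
      (cos (u + j%:R * (pi / 2)) / j`!%:R) * (j%:R * x ^+ j.-1).
    rewrite big_ord_recl/= !mul0r mulr0 add0r /g'; congr (_ - _).
      by rewrite addrAC cosDpihalf.
    apply: eq_bigr => j _; rewrite /bump/= add1n.
    have -> : u + pi / 2 + j%:R * (pi / 2) = u + j.+1%:R * (pi / 2) by rewrite -natr1;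
        ring.
    rewrite factS natrM invfM -!mulrA; congr (_ * _).
    by rewrite [RHS]mulrCA mulKf ?pnatr_eq0// mulrC.
  apply: is_deriveB.
  + have h1 : is_derive x 1 (+%R u) 1.
      by rewrite -[X in is_derive _ _ _ X]add0r; apply: is_deriveD.
    by apply: is_derive_eq; rewrite mulr1.
  + apply: is_derive_sum => j; apply: is_derive_eq.
    by rewrite /GRing.scale/= mulr1.
- by move=> x x0; exact: IH.
Qed.

Lemma cosD_taylor (R : realType) (m : nat) (u v : R) :
  `|cos (u + v) - \sum_(j < m) cos (u + j%:R * (pi / 2)) * (v ^+ j / j`!%:R)| <=
  `|v| ^+ m / m`!%:R.
Proof.
have [v0|v0] := leP 0 v; first by rewrite [`|v|]ger0_norm//; exact: cosD_taylor_ge0.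
have nv0 : 0 <= - v by rewrite oppr_ge0 ltW.
rewrite [`|v|]ltr0_norm//.
(* Passing to -u and -v keeps the cosine and multiplies the j-th coefficient by (-1)^j, which turns
   (-v)^j back into v^j. *)
have cosBnpi n (x : R) : cos (x - n%:R * (pi / 2)) = cos (x + n%:R * (pi / 2)) * (-1)
    ^+ n.
  elim: n x => [|n IH] x; first by rewrite mul0r subr0 addr0 expr0 mulr1.
  rewrite -nat1r mulrDl mul1r opprD addrA IH exprS mulN1r.
  have -> : x + (pi / 2 + n%:R * (pi / 2)) = x - pi / 2 + n%:R * (pi / 2) + pi by field.
  by rewrite cosDpi mulrNN.
have := cosD_taylor_ge0 m (- u) nv0; rewrite -opprD cosN.
rewrite (eq_bigr (fun j : 'I_m => cos (u + j%:R * (pi / 2)) * (v ^+ j / j`!%:R)))//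
  => j _.
rewrite -cosN opprD opprK cosBnpi -!mulrA; congr (_ * _); rewrite mulrA; congr (_ / _).
by rewrite -exprMn mulrN mulN1r opprK.
Qed.

(* Bang's induction: f has level N at x if |f_n x| <= e^(n-N) M_n for all n, and
   moving by at most M_(N-1) / (e M_N) costs one level. *)
Lemma bang_step (R : realType) (f : nat -> R -> R) (M : nat -> R) (N : nat) (x s : R) :
  (forall n, 0 < M n) ->
  (forall n, M n.+1 ^+ 2 <= M n * M n.+2) ->
  (forall n m t s, `|f n (t + s) - \sum_(j < m) f (n + j)%N t * (s ^+ j / j`!%:R)| <=
    M (n + m)%N * (`|s| ^+ m / m`!%:R)) ->
  (forall n, `|f n x| <= expR (n%:R - N.+1%:R) * M n) ->
  0 <= s <= M N / (expR 1 * M N.+1) ->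
  forall n, `|f n (x + s)| <= expR (n%:R - N%:R) * M n.
Proof.
move=> M0 Mlc taylor lvl /andP[s0 sle] n.
have e0 : 0 < expR 1 :> R by exact: expR_gt0.
(* For n >= N the exponential is at least 1, and the Taylor bound of order 0 already gives |f_n| <=
   M_n. *)
have [Nn|nN] := leqP N n.
  have := taylor n 0%N x s; rewrite big_ord0 subr0 addn0 expr0 divr1 mulr1 => /le_trans.
  apply; rewrite ler_peMl// ?(ltW (M0 n))//.
  by rewrite -[leLHS]expR0 ler_expR subr_ge0 ler_nat.
pose rho := M N.+1 / M N.
have rho0 : 0 < rho by rewrite divr_gt0.
(* Log-convexity makes the ratios of M nondecreasing, so below index N+1 each of them is at most
   [rho]. *)
have mono k l : (k <= l)%N -> M k.+1 / M k <= M l.+1 / M l.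
  move=> kl; rewrite -(subnK kl); elim: (l - k)%N => [|i IH]; first by rewrite add0n.
  rewrite addSn (le_trans IH)// ler_pdivrMr// mulrAC ler_pdivlMr//.
  by rewrite -expr2 mulrC.
have growth j : (n + j <= N.+1)%N -> M (n + j)%N <= M n * rho ^+ j.
  elim: j => [|j IH] nj; first by rewrite addn0 expr0 mulr1.
  rewrite addnS in nj *.
  apply: (@le_trans _ _ (M (n + j)%N * rho)).
    by rewrite mulrC -ler_pdivrMr//; apply: mono; rewrite -ltnS.
  by rewrite exprSr mulrA ler_wpM2r ?(ltW rho0)// IH// ltnW.
(* This order makes the remainder involve M_(N+1), with exponential factor 1: it becomes the term j
   = m of a sum in which the other terms are bounded by the level at x. *)
set m := (N.+1 - n)%N.
have nm : (n + m = N.+1)%N by rewrite subnKC// ltnW// ltnS ltnW.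
have := taylor n m x s; rewrite nm [`|s|]ger0_norm// => h.
have {h} : `|f n (x + s)| <= \sum_(j < m.+1) expR (n%:R + j%:R - N.+1%:R) * M (n + j)%N
    * (s ^+ j / j`!%:R).
  rewrite big_ord_recr/= -natrD nm subrr expR0 mul1r.
  rewrite -lerBlDl; apply: le_trans h.
  apply: le_trans (lerB_dist _ _); rewrite lerD2l lerN2.
  apply: (le_trans (ler_norm_sum _ _ _)); apply: ler_sum => j _.
  rewrite normrM [X in _ * X]ger0_norm ?divr_ge0 ?exprn_ge0//.
  by rewrite ler_wpM2r ?divr_ge0 ?exprn_ge0// -natrD.
move=> /le_trans; apply.
have -> : n%:R - N%:R = n%:R - N.+1%:R + 1 :> R by rewrite -natr1; lra.
rewrite expRD -mulrA [expR 1 * _]mulrC mulrA.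
(* The bound on s says that e * rho * s <= 1. What remains is a partial sum of the exponential
   series at 1, and its bound e is the loss of one level. *)
apply: (@le_trans _ _ (\sum_(j < m.+1) expR (n%:R - N.+1%:R) * M n * (1 ^+ j / j`!%:R))).
  apply: ler_sum => j _.
  rewrite !mulrA ler_wpM2r ?invr_ge0// addrAC expRD -!mulrA ler_wpM2l ?expR_ge0//.
  have -> : expR (j%:R : R) = expR 1 ^+ j by rewrite -expRM_natl mulr1.
  apply: (@le_trans _ _ (M n * (expR 1 * rho * s) ^+ j)).
    rewrite [leRHS](_ : _ = expR 1 ^+ j * (M n * rho ^+ j * s ^+ j)); last first.
      by rewrite !exprMn; ring.
    rewrite ler_wpM2l ?exprn_ge0 ?expR_ge0// ler_wpM2r ?exprn_ge0//.
    by apply: growth; rewrite -nm leq_add2l -ltnS.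
  have q0 : 0 <= expR 1 * rho * s := mulr_ge0 (mulr_ge0 (expR_ge0 _) (ltW rho0)) s0.
  rewrite ler_wpM2l ?(ltW (M0 n))// lerXn2r ?nnegrE//.
  move: sle; rewrite ler_pdivlMr ?mulr_gt0// => sle.
  have -> : expR 1 * rho * s = s * (expR 1 * M N.+1) / M N by rewrite /rho; ring.
  by rewrite ler_pdivrMr// mul1r.
rewrite -mulr_sumr ler_wpM2l ?mulr_ge0 ?expR_ge0 ?(ltW (M0 n))//.
rewrite [leLHS](_ : _ = series (exp_coeff (1 : R)) m.+1).
  apply: nondecreasing_cvgn_le; last exact: is_cvg_series_exp_coeff.
  by apply: nondecreasing_series => i _ _; exact: exp_coeff_ge0.
by rewrite /series/= big_mkord.
Qed.

(** At 0 every level holds. A walk to the right made of steps a_(K+N-1), ..., a_K goes down from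
    level K+N to level K, and the divergence from any K on lets it reach x. Thus |f_0 x| <= e^(-K)
    M_0 for every K. The induction peels off the last step a_K, hence raises K. *)
Lemma bang_vanishing (R : realType) (f : nat -> R -> R) (M : nat -> R) :
  (forall n, 0 < M n) ->
  (forall n, M n.+1 ^+ 2 <= M n * M n.+2) ->
  (forall A : R, exists N, A <= \sum_(n < N) M n / M n.+1) ->
  (forall n m t s, `|f n (t + s) - \sum_(j < m) f (n + j)%N t * (s ^+ j / j`!%:R)| <=
    M (n + m)%N * (`|s| ^+ m / m`!%:R)) ->
  (forall n, f n 0 = 0) -> forall x, 0 <= x -> f 0%N x = 0.
Proof.
move=> M0 Mlc dv taylor f0 x x0.
have e0 : 0 < expR 1 :> R by exact: expR_gt0.
pose a n := M n / (expR 1 * M n.+1).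
have a0 n : 0 <= a n by rewrite divr_ge0 ?mulr_ge0 ?ltW.
have lvl0 K : forall n, `|f n 0| <= expR (n%:R - K%:R) * M n.
  by move=> n; rewrite f0 normr0 mulr_ge0 ?expR_ge0// ltW.
have lvl N K y : 0 <= y <= \sum_(n < N) a (K + n)%N ->
    forall n, `|f n y| <= expR (n%:R - K%:R) * M n.
  elim: N K y => [|N IH] K y.
    rewrite big_ord0 => /le_anti <-; exact: lvl0.
  rewrite big_ord_recl addn0 => /andP[y0 yle].
  have [ya|ay] := leP y (a K).
    have := bang_step M0 Mlc taylor (lvl0 K.+1); move=> /(_ y).
    by rewrite add0r; apply; rewrite y0.
  have step := @bang_step _ f M K (y - a K) (a K) M0 Mlc taylor.
  rewrite subrK in step; apply: step; last by rewrite a0/=.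
  apply: IH; rewrite subr_ge0 ltW//= lerBlDl.
  apply: (le_trans yle); rewrite lerD2l; apply: ler_sum => i _.
  by rewrite lift0 addnS.
have fK K : `|f 0%N x| <= expR (- K%:R) * M 0%N.
  have [N hN] := dv (expR 1 * x + \sum_(n < K) M n / M n.+1).
  rewrite -[- _]add0r; apply: (lvl N).
  rewrite x0/= -(ler_pM2l e0) mulr_sumr.
  have := hN; rewrite -lerBrDr => /le_trans; apply.
  have -> : \sum_(i < N) expR 1 * a (K + i)%N =
      \sum_(i < N) M (K + i)%N / M (K + i).+1.
    by apply: eq_bigr => i _; rewrite /a invfM mulrCA mulVKf ?gt_eqF.
  rewrite lerBlDr addrC.
  have -> : \sum_(n < K) M n / M n.+1 + \sum_(i < N) M (K + i)%N / M (K + i).+1 =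
     \sum_(n < K + N) M n / M n.+1 by rewrite big_split_ord.
  rewrite addnC big_split_ord/= lerDl; apply: sumr_ge0 => i _.
  by rewrite divr_ge0// ltW.
apply/eqP; rewrite -normr_le0 leNgt; apply/negP => fx0.
pose K := Num.bound (M 0%N / `|f 0%N x|).
have hK : M 0%N / `|f 0%N x| < K%:R.
  by rewrite (le_lt_trans _ (archi_boundP _))// ?divr_ge0// ltW.
have := fK K; rewrite expRN mulrC ler_pdivlMr ?expR_gt0// leNgt => /negP; apply.
move: hK; rewrite ltr_pdivrMr// mulrC => /lt_le_trans; apply.
rewrite ler_wpM2l//; apply: le_trans (expR_ge1Dx _); by rewrite lerDr.
Qed.

(** * The Borel sets of R^d *)

Section borel.
Context {R : realType} {d : nat}.
Notation Rd := (borelRd R d).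

Lemma measurable_coord (i : 'I_d) :
  measurable_fun [set: Rd] (fun x : Rd => x i 0 : R).
Proof.
apply: (measurability (@RGenOpens.G R)); first exact: RGenOpens.measurableE.
move=> _ [A [a [b ->]] <-]; rewrite setTI; apply: sub_sigma_algebra.
by apply: open_comp; [move=> x _; exact: coord_continuous|exact: itv_open].
Qed.

(** An open set is the countable union of the rational boxes inside it, and the preimage of a box is
    a finite intersection of coordinate conditions. The source is arbitrary, so that R^d with the
    sigma-algebra generated by the orthants can be taken for V. *)
Lemma measurable_preimage_open (dV : measure_display) (V : measurableType dV)
    (f : V -> 'cV[R]_d) :
  (forall i, measurable_fun setT (fun v => f v i 0)) ->
  forall U, open U -> measurable (f @^-1` U).
Proof.
move=> mf U oU.
pose box (k : 'cV[rat]_d * nat) := [set x : 'cV[R]_d |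
  forall i, `|x i 0 - ratr (k.1 i 0)| < k.2.+1%:R^-1].
have -> : U = \bigcup_(k in [set k | box k `<=` U]) box k.
  apply/seteqP; split => [x Ux|x [k /= kU /kU]//].
  have /nbhs_ballP[e /= e0 xe] : nbhs x U by exact: open_nbhs_nbhs.
  have [n ne] : exists n : nat, n.+1%:R^-1 < e / 2.
    have e2 : 0 < e / 2 by rewrite divr_gt0.
    by have [n] := ltr_add_invr e2; rewrite add0r; exists n.
  have q_ex i : exists q : rat, `|x i 0 - ratr q| < n.+1%:R^-1.
    have : x i 0 - n.+1%:R^-1 < x i 0 + n.+1%:R^-1.
      by rewrite ltrD2l gtrN// invr_gt0.
    move=> /rat_in_itvoo[q]; rewrite in_itv/= => /andP[q1 q2]; exists q.
    by rewrite ltr_distl; apply/andP; split; rewrite -?ltrBlDr// ltrBlDr.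
  pose q : 'cV[rat]_d := \col_i projT1 (cid (q_ex i)).
  have qP i : `|x i 0 - ratr (q i 0)| < n.+1%:R^-1.
    by rewrite mxE; case: cid.
  exists (q, n) => //= y yq; apply: xe; split => // i j.
  rewrite ord1 -ball_normE/= (splitr e).
  rewrite (_ : x i 0 - y i 0 = (x i 0 - ratr (q i 0)) - (y i 0 - ratr (q i 0)));
    last by lra.
  rewrite (le_lt_trans (ler_normB _ _))// ltrD//.
    exact: lt_trans (qP i) ne.
  exact: lt_trans (yq i) ne.
rewrite preimage_bigcup bigcup_mkcond; apply: countable_bigcupT_measurable => //.
move=> k; case: ifPn => // _.
rewrite (_ : _ @^-1` _ = \bigcap_(i in [set: 'I_d])
  ((fun v => f v i 0) @^-1` [set y | `|y - ratr (k.1 i 0)| < k.2.+1%:R^-1])); last first.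
  by apply/seteqP; split => v /= vk i; [move=> _; exact: vk|exact: vk].
apply: fin_bigcap_measurable => // i _.
rewrite -[X in measurable X]setTI; apply: mf => //.
rewrite (_ : [set _ | _] = ball (ratr (k.1 i 0) : R) k.2.+1%:R^-1).
  by apply: measurable_ball.
by apply/seteqP; split => y /=; rewrite -ball_normE/= distrC.
Qed.

Lemma measurable_fun_borelRd (dV : measure_display) (V : measurableType dV)
    (f : V -> Rd) :
  (forall i, measurable_fun setT (fun v => f v i 0)) -> measurable_fun setT f.
Proof.
move=> mf; apply: (@measurability _ _ V Rd setT f (@open 'cV[R]_d)) => //.
by move=> _ [A oA <-]; rewrite setTI; exact: measurable_preimage_open.
Qed.

Lemma measurable_inner (dV : measure_display) (V : measurableType dV) (f g : V -> Rd) :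
  measurable_fun setT f -> measurable_fun setT g ->
  measurable_fun setT (fun v => inner (f v) (g v)).
Proof.
move=> mf mg; apply: measurable_sum => i; apply: measurable_funM.
  exact: (measurableT_comp (measurable_coord i) mf).
exact: (measurableT_comp (measurable_coord i) mg).
Qed.

Lemma measurable_mulmx (T : 'M[R]_d) : measurable_fun setT (mulmx T : Rd -> Rd).
Proof.
apply: measurable_fun_borelRd => i.
apply: (eq_measurable_fun (fun v : Rd => \sum_j T i j * v j 0)).
  by move=> v _; rewrite mxE.
apply: measurable_sum => j; apply: measurable_funM => //; exact: measurable_coord.
Qed.

Lemma measurable_enorm : measurable_fun setT (enorm : Rd -> R).
Proof.
have msqrt : measurable_fun setT (Num.sqrt : R -> R).
  by apply: continuous_measurable_fun => x; exact: sqrt_continuous.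
by apply: (measurableT_comp msqrt); exact: measurable_inner.
Qed.

(** Leaving the coordinates outside [I] free puts the whole space in the family and makes it stable
    under intersection, as the uniqueness theorem for measures asks. *)
Definition orthant (I : pred 'I_d) (a : 'I_d -> R) : set Rd :=
  [set x | forall i, I i -> a i <= x i 0].

Lemma measurable_orthant I a : measurable (orthant I a).
Proof.
rewrite (_ : orthant I a = \bigcap_(i in [set i | I i])
    ((fun x : Rd => x i 0) @^-1` `[a i, +oo[)); last first.
  apply/seteqP; split => x /= xa i; first by move=> Ii; rewrite /= in_itv/= andbT;
    exact: xa.
  by move=> /xa /=; rewrite in_itv/= andbT.
apply: fin_bigcap_measurable => // i _.
by rewrite -[X in measurable X]setTI; apply: measurable_coord.
Qed.

Lemma measure_eq_orthant (P Q : probability Rd R) :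
  (forall I a, P (orthant I a) = Q (orthant I a)) ->
  forall B, measurable B -> P B = Q B.
Proof.
move=> PQ.
pose G := [set A | exists I a, A = orthant I a].
have GT : G setT.
  by exists pred0, (fun=> 0); apply/seteqP; split => x.
apply: (measure_unique G (fun=> setT)) => //.
- apply/seteqP; split.
    apply: smallest_sub; first exact: smallest_sigma_algebra.
    move=> U oU; rewrite -[U]preimage_id.
    apply: (@measurable_preimage_open _ (g_sigma_algebraType G) id) => // i.
    apply: (measurability (@RGenCInfty.G R)); first exact: RGenCInfty.measurableE.
    move=> _ [A [a ->] <-]; rewrite setTI; apply: sub_sigma_algebra.
    exists (pred1 i), (fun=> a); apply/seteqP; split => x /=.
      by rewrite in_itv/= andbT => ax j /eqP ->.
    by move=> /(_ i); rewrite in_itv/= andbT; apply.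
  apply: smallest_sub; first exact: sigma_algebra_measurable.
  by move=> _ [I [a ->]]; exact: measurable_orthant.
- move=> _ _ [I [a ->]] [J [b ->]].
  exists (predU I J), (fun i => if I i then if J i then Num.max (a i) (b i) else a i
    else b i).
  apply/seteqP; split => [x [xa xb] i /=|x /= xab].
    move: (xa i) (xb i).
    by case: (I i); case: (J i) => //= xai xbi _; rewrite ?ge_max ?xai ?xbi.
  split=> i /= Ii; have := xab i; rewrite /= Ii ?orbT; last first.
    by case: (I i) => /(_ isT)//; rewrite ge_max => /andP[].
  by case: (J i) => /(_ isT)//; rewrite ge_max => /andP[].
- exact: bigcup_const.
- by move=> _ [I [a ->]]; exact: PQ.
- by move=> _ /=; rewrite (le_lt_trans (probability_le1 P measurableT))// ltry.
Qed.

End borel.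

(** * Zero sets of polynomials *)

(** Being polynomial on every line passes to slices and is easy to check for moments; it stands in
    for polynomials in several variables. *)
Definition linewise_polynomial (R : realType) (d : nat) (f : 'cV[R]_d -> R) :=
  forall a v : 'cV[R]_d, exists p : {poly R}, forall t, f (a + t *: v) = p.[t].

Lemma finite_roots (R : idomainType) (p : {poly R}) :
  p != 0 -> finite_set [set x | root p x].
Proof.
move=> p0; apply: contrapT => /(@infinite_set_fset _ _ (size p))[B Bp szB].
have := @max_poly_roots _ p (finmap.enum_fset B) p0.
rewrite ltnNge szB => /(_ _ (finmap.fset_uniq B)) h; suff: false by [].
by apply: h; apply/allP => x xB; apply: Bp.
Qed.

(** Measurability of g is derived, every subset of F being Borel: in the use below, g measures the
    slices of a set about which only an inclusion is known. *)
Lemma integral_eq0_off_finite (R : realType) (g : R -> \bar R) (F : set R) :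
  finite_set F -> (forall t, ~ F t -> g t = 0%E) ->
  (\int[@lebesgue_measure R]_t g t = 0)%E.
Proof.
move=> finF g0.
have mF A : A `<=` F -> measurable A.
  move=> AF; apply: countable_measurable => //.
  exact/finite_set_countable/(sub_finite_set AF).
have mg : measurable_fun setT g.
  move=> _ Y mY; rewrite setTI.
  have -> : g @^-1` Y = (g @^-1` Y `&` F) `|` (g @^-1` Y `&` ~` F).
    by rewrite -setIUr setUv setIT.
  apply: measurableU.
    by apply: mF => x [].
  have [Y0|Y0] := pselect (Y 0%E).
    have -> : g @^-1` Y `&` ~` F = ~` F.
      by apply/seteqP; split=> [x []//|x Fx]; split => //=; rewrite g0.
    by apply: measurableC; apply: mF.
  have -> : g @^-1` Y `&` ~` F = set0; last exact: measurable0.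
  by rewrite -subset0 => x [/= + Fx]; rewrite g0.
rewrite (ae_eq_integral (cst 0%E))//; first by rewrite integral0.
exists F; split; [exact: mF|exact/countable_lebesgue_measure0/finite_set_countable|].
by move=> x /= gx; apply: contrapT => /g0 gx0; apply: gx => _.
Qed.

(** On the line through a point with f x != 0 along the first axis, f is a nonzero polynomial. Off
    its finitely many roots t, the slice of f at t is not identically zero and the induction
    hypothesis applies to it. *)
Lemma linewise_polynomial_zeros (R : realType) (d : nat) (f : 'cV[R]_d -> R)
    (S : set (borelRd R d)) :
  linewise_polynomial f -> (exists x, f x != 0) -> S `<=` [set x | f x = 0] ->
  lebesgueRd S = 0%E.
Proof.
elim: d f S => [f S _ [x fx] Sf|d IH f S fp [x fx] Sf] /=.
  rewrite indicE memNset// => S0; move: fx.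
  by rewrite (_ : x = 0) ?(Sf _ S0) ?eqxx//; apply/matrixP => -[].
have line (a b v w : 'M[R]_(_, 1)) (t : R) :
    (col_mx a b : 'cV[R]_(1 + d)) + t *: col_mx v w = col_mx (a + t *: v) (b + t *: w).
  by rewrite scale_col_mx add_col_mx.
pose x1 : 'M[R]_1 := usubmx (x : 'cV[R]_(1 + d)).
pose x2 : 'cV[R]_d := dsubmx (x : 'cV[R]_(1 + d)).
have xE : x = col_mx x1 x2 by rewrite vsubmxK.
have [p pE] := fp (col_mx (0 : 'M[R]_1) x2) (col_mx (1%:M : 'M[R]_1) 0).
have {}pE t : f (col_mx (t%:M : 'M[R]_1) x2) = p.[t].
  by rewrite -pE line add0r scaler0 addr0 scalemx1.
have p0 : p != 0.
  apply: contraNneq fx => p0; rewrite xE [x1]mx11_scalar pE p0.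
  by rewrite horner0.
apply: (@integral_eq0_off_finite _ _ [set t | root p t]); first exact: finite_roots.
move=> t pt; apply: (IH (fun y => f (col_mx (t%:M : 'M[R]_1) y))).
- move=> a v; have [q qE] := fp (col_mx (t%:M : 'M[R]_1) a) (col_mx (0 : 'M[R]_1) v).
  by exists q => s; rewrite -qE line scaler0 addr0.
- by exists x2; rewrite pE; apply/negP.
- by move=> y /Sf.
Qed.

Lemma inner_linewise (R : realType) (d : nat) (h : 'cV[R]_d) (c : R) :
  linewise_polynomial (fun x => inner h x - c).
Proof.
move=> a v; exists ((inner h a - c)%:P + inner h v *: 'X) => t.
rewrite !hornerE /inner mulrC mulr_sumr [RHS]addrAC -big_split/=.
congr (_ - _); apply: eq_bigr => i _; rewrite !mxE; ring.
Qed.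

Lemma hyperplane_null (R : realType) (d : nat) (h : 'cV[R]_d) (c : R)
    (S : set (borelRd R d)) : h != 0 -> S `<=` [set x | inner h x = c] ->
  lebesgueRd S = 0%E.
Proof.
move=> h0 Sh; apply: (linewise_polynomial_zeros (inner_linewise h c)); last first.
  by move=> x /Sh /= ->; rewrite subrr.
have [i hi] : exists i, h i 0 != 0.
  apply: contrapT => h_; move/eqP: h0; apply; apply/colP => i; rewrite mxE.
  by apply: contrapT => /eqP hi; apply: h_; exists i.
exists (((c + 1) / h i 0) *: delta_mx i 0); rewrite /inner (bigD1 i)//= big1.
  by rewrite !mxE !eqxx mulr1 addr0 mulrC divfK// addrAC subrr add0r oner_neq0.
by move=> j ji; rewrite !mxE (negbTE ji) !mulr0.
Qed.

(** * Trigonometric polynomials determine a probability *)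

(* [iter n cubic_step] converges to the sign function on [-1, 1]; as a
   polynomial it maps trigonometric polynomials to trigonometric polynomials. *)
Definition cubic_step (R : realType) (s : R) : R := s * (3 - s ^+ 2) / 2.

(** From x in (0, 1] the iterates u increase, and 1 - cubic_step u = (1 - u)(1 - u(1 + u)/2), so the
    distance to 1 shrinks by the factor 1 - x/2 at least. Negative s follows by oddness. *)
Lemma cubic_step_cvg_sg (R : realType) (s : R) : `|s| <= 1 ->
  iter n (@cubic_step R) s @[n --> \oo] --> Num.sg s.
Proof.
have pos (x : R) : 0 < x <= 1 -> iter n (@cubic_step R) x @[n --> \oo] --> (1 : R).
  move=> /andP[x0 x1].
  have inv n : x <= iter n (@cubic_step R) x <= 1 /\
      1 - iter n (@cubic_step R) x <= (1 - x / 2) ^+ n.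
    elim: n => [|n [/andP[IH1 IH2] IH3]]; first by rewrite /= lexx x1 expr0;
      split=> //; lra.
    rewrite iterS; set u := iter n _ x in IH1 IH2 IH3 *.
    have e : 1 - cubic_step u = (1 - u) * (1 - u * (1 + u) / 2).
      by rewrite /cubic_step; field.
    have uu : 0 <= u * (1 + u) / 2 <= 1 by apply/andP; split; nra.
    have ge : u <= cubic_step u.
      rewrite -subr_ge0 (_ : _ - _ = u * (1 - u) * (1 + u) / 2).
        by rewrite divr_ge0// mulr_ge0 ?mulr_ge0//; lra.
      by rewrite /cubic_step; field.
    split.
      rewrite (le_trans IH1 ge)/= -subr_ge0 e mulr_ge0//; lra.
    rewrite e exprSr ler_pM//; [lra|lra|].
    by rewrite lerD2l lerN2 ler_pM2r ?invr_gt0//; nra.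
  have : 1 - (1 - x / 2) ^+ n @[n --> \oo] --> (1 - 0 : R).
    by apply: cvgB; [exact: cvg_cst|apply: cvg_expr; rewrite ger0_norm; lra].
  rewrite subr0 => h.
  apply: (squeeze_cvgr _ h (cvg_cst _)).
  apply: nearW => n /=; have [/andP[_ h1] h2] := inv n; rewrite h1 andbT; lra.
have [s0|s0|->] := ltrgt0P s.
- by move=> s1; rewrite gtr0_sg//; apply: pos; rewrite s0.
- move=> s1; rewrite ltr0_sg//.
  have -> : (fun n => iter n (@cubic_step R) s) = (fun n => - iter n (@cubic_step R) (-
      s)).
    apply/funext => n; elim: n => [|n IH]; first by rewrite /= opprK.
    by rewrite !iterS IH /cubic_step sqrrN !mulNr.
  by apply: cvgN; apply: pos; rewrite oppr_gt0 s0.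
- move=> _; rewrite sgr0 (_ : (fun n => _) = fun=> 0); first exact: cvg_cst.
  by apply/funext => n; elim: n => //= n ->; rewrite /cubic_step !mul0r.
Qed.

Lemma cubic_step_bound (R : realType) (s : R) : `|s| <= 1 -> `|cubic_step s| <= 1.
Proof.
rewrite !ler_norml => /andP[s1 s2]; apply/andP; split; rewrite -subr_ge0.
  have -> : cubic_step s - -1 = (1 + s) ^+ 2 * (2 - s) / 2 by rewrite /cubic_step; field.
  by rewrite divr_ge0// mulr_ge0 ?sqr_ge0//; lra.
have -> : 1 - cubic_step s = (1 - s) ^+ 2 * (2 + s) / 2 by rewrite /cubic_step; field.
by rewrite divr_ge0// mulr_ge0 ?sqr_ge0//; lra.
Qed.

Lemma bounded_integrable (dT : measure_display) (T : measurableType dT) (R : realType)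
    {P : probability T R} (f : T -> R) (B : R) :
  measurable_fun setT f -> (forall x, `|f x| <= B) ->
  P.-integrable setT (EFin \o f).
Proof.
move=> mf fB.
apply: (@le_integrable _ _ _ _ setT _ (EFin \o f) (EFin \o cst B)) => //.
- exact/measurable_EFinP.
- by move=> x _ /=; rewrite lee_fin (le_trans (fB x))// ler_norm.
- exact: finite_measure_integrable_cst.
Qed.

Section trigonometric_determinacy.
Context {R : realType} {d : nat}.
Notation Rd := (borelRd R d).

(** The phase [c] supplies sines and constants, so the product-to-sum formula makes this real class
    an algebra without complex exponentials. *)
Inductive trig_poly : (Rd -> R) -> Prop :=
| trig_cos h c : trig_poly (fun x => cos (inner h x + c))
| trig_add f g : trig_poly f -> trig_poly g -> trig_poly (fun x => f x + g x)
| trig_scale k f : trig_poly f -> trig_poly (fun x => k * f x).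

Lemma innerDl (u v x : 'cV[R]_d) : inner (u + v) x = inner u x + inner v x.
Proof. by rewrite /inner -big_split/=; apply: eq_bigr => i _; rewrite mxE mulrDl. Qed.

Lemma innerZl k (u x : 'cV[R]_d) : inner (k *: u) x = k * inner u x.
Proof. by rewrite /inner mulr_sumr; apply: eq_bigr => i _; rewrite mxE mulrA. Qed.

Lemma innerNl (u x : 'cV[R]_d) : inner (- u) x = - inner u x.
Proof. by rewrite -scaleN1r innerZl mulN1r. Qed.

Lemma inner0l (x : 'cV[R]_d) : inner 0 x = 0.
Proof. by rewrite -[0](scale0r 0) innerZl mul0r. Qed.

Lemma trig_mul f g : trig_poly f -> trig_poly g -> trig_poly (fun x => f x * g x).
Proof.
move=> tf; elim: tf g => {f} [h c|f f' _ IHf _ IHf'|k f _ IHf] g tg.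
- elim: tg => {g} [h' c'|g g' _ IHg _ IHg'|k g _ IHg].
  + rewrite (_ : (fun x => _) = fun x => 2^-1 * (cos (inner (h + h') x + (c + c')) +
      cos (inner (h - h') x + (c - c')))).
      by apply: trig_scale; apply: trig_add; apply: trig_cos.
    apply/funext => x; rewrite !innerDl innerNl.
    rewrite addrACA (_ : inner h x - _ + _ = (inner h x + c) - (inner h' x + c'));
      last by ring.
    by move: (inner h x + c) (inner h' x + c') => A B; rewrite cosB cosD; field.
  + rewrite (_ : (fun x => _) = fun x => cos (inner h x + c) * g x +
      cos (inner h x + c) * g' x); first exact: trig_add.
    by apply/funext => x; rewrite mulrDr.
  + rewrite (_ : (fun x => _) = fun x => k * (cos (inner h x + c) * g x)); first exact:
      trig_scale.
    by apply/funext => x; rewrite mulrCA.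
- rewrite (_ : (fun x => _) = fun x => f x * g x + f' x * g x); last first.
    by apply/funext => x; rewrite mulrDl.
  by apply: trig_add; [exact: IHf|exact: IHf'].
- rewrite (_ : (fun x => _) = fun x => k * (f x * g x)); last first.
    by apply/funext => x; rewrite mulrA.
  by apply: trig_scale; exact: IHf.
Qed.

Lemma trig_cst k : trig_poly (fun=> k).
Proof.
rewrite (_ : (fun=> k) = fun x => k * cos (inner 0 x + 0)).
  by apply: trig_scale; exact: trig_cos.
by apply/funext => x; rewrite inner0l addr0 cos0 mulr1.
Qed.

Lemma trig_iter_cubic n f : trig_poly f ->
  trig_poly (fun x => iter n (@cubic_step R) (f x)).
Proof.
move=> tf; elim: n => [//|n IH].
rewrite (_ : (fun x => _) = fun x => 2^-1 * (iter n (@cubic_step R) (f x) *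
  (3 + (-1) * (iter n (@cubic_step R) (f x) * iter n (@cubic_step R) (f x)))));
    last first.
  by apply/funext => x; rewrite iterS /cubic_step mulN1r -expr2 mulrC.
apply: trig_scale; apply: trig_mul => //; apply: trig_add; first exact: trig_cst.
by apply: trig_scale; exact: trig_mul.
Qed.

Lemma trig_prod (I : pred 'I_d) (f : 'I_d -> Rd -> R) :
  (forall i, trig_poly (f i)) -> trig_poly (fun x => \prod_(i | I i) f i x).
Proof.
move=> tf.
have H (s : seq 'I_d) : trig_poly (fun x => \prod_(i <- s | I i) f i x).
  elim: s => [|i s IH].
    by under eq_fun do rewrite big_nil; exact: trig_cst.
  have [Ii|Ii] := boolP (I i).
    by under eq_fun do rewrite big_cons Ii; apply: trig_mul.
  by under eq_fun do rewrite big_cons (negbTE Ii).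
exact: H.
Qed.

(** The bound 1 is the dominating function that makes the property stable under pointwise limits. *)
Definition agree (P Q : probability Rd R) (f : Rd -> R) :=
  [/\ measurable_fun setT f, (forall x, `|f x| <= 1) &
    (\int[P]_x (f x)%:E = \int[Q]_x (f x)%:E)%E].

Lemma agree_cvg (P Q : probability Rd R) (f_ : nat -> Rd -> R) f :
  (forall n, agree P Q (f_ n)) -> (forall x, f_ n x @[n --> \oo] --> f x) ->
  agree P Q f.
Proof.
move=> f_P fc.
have mf : measurable_fun setT f.
  apply: (@measurable_fun_cvg _ Rd R setT f_ f) => [n|x _]; last exact: fc.
  by have [] := f_P n.
split => //.
  move=> x; have f1 n : -1 <= f_ n x <= 1 by rewrite -ler_norml; have [_] := f_P n.
  have cvx : cvgn (fun n => f_ n x) by apply/cvg_ex; exists (f x); exact: fc.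
  rewrite -(cvg_lim _ (fc x))// ler_norml; apply/andP; split.
    by apply: limr_ge => //; apply: nearW => n; have /andP[] := f1 n.
  by apply: limr_le => //; apply: nearW => n; have /andP[] := f1 n.
have lim (M : probability Rd R) : (\int[M]_x (f_ n x)%:E)%E @[n --> \oo] -->
    (\int[M]_x (f x)%:E)%E.
  apply: (@dominated_cvg _ _ _ _ _ _ (fun n x => (f_ n x)%:E) (fun x => (f x)%:E) (EFin
    \o cst 1)) => //.
  - by move=> n; apply/measurable_EFinP; have [] := f_P n.
  - by move=> x _; apply: cvg_EFin; [exact: nearW|exact: fc].
  - exact: finite_measure_integrable_cst.
  - by move=> n x _ /=; rewrite lee_fin; have [_] := f_P n.
have := lim P; rewrite (_ : (fun n => _) = (fun n => \int[Q]_x (f_ n x)%:E)%E).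
  by move=> limP; apply: (cvg_unique _ limP (lim Q)).
by apply/funext => n; have [] := f_P n.
Qed.

Lemma trig_agree (P Q : probability Rd R) f :
  (forall h c, \int[P]_x (cos (inner h x + c))%:E =
      \int[Q]_x (cos (inner h x + c))%:E)%E ->
  trig_poly f -> (forall x, `|f x| <= 1) -> agree P Q f.
Proof.
move=> PQ tf f1; suff [mf _ ?] : [/\ measurable_fun setT f,
    exists B : R, forall x, `|f x| <= B &
    (\int[P]_x (f x)%:E = \int[Q]_x (f x)%:E)%E] by split.
elim: tf {f1} => {f} [h c|f g _ [mf [B fB] If] _ [mg [C gC] Ig]|k f _ [mf [B fB] If]].
- split; last exact: PQ.
  + apply: (measurableT_comp (continuous_measurable_fun (@continuous_cos R)));
      apply: measurable_funD => //.
    exact: measurable_inner.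
  + by exists 1 => x; rewrite ler_norml cos_geN1 cos_le1.
- split; first exact: measurable_funD.
  + by exists (B + C) => x; rewrite (le_trans (ler_normD _ _))// lerD.
  + have ie (M : probability Rd R) : (\int[M]_x (f x + g x)%:E =
        \int[M]_x (f x)%:E + \int[M]_x (g x)%:E)%E.
      apply: integralD_EFin => //; [exact: bounded_integrable fB|exact:
        bounded_integrable gC].
    by rewrite !ie If Ig.
- split; first exact: measurable_funM.
  + by exists (`|k| * B) => x; rewrite normrM ler_wpM2l.
  + have ie (M : probability Rd R) : (\int[M]_x (k * f x)%:E =
      k%:E * \int[M]_x (f x)%:E)%E.
      under eq_integral do rewrite EFinM.
      by rewrite integralZl//; exact: bounded_integrable fB.
    by rewrite !ie If.
Qed.

(** The indicator of an orthant is an iterated limit of trigonometric polynomials: cubic steps turn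
    [sin (u m i x)] into its sign, (1 + sign)/2 is a zero-one function off the zeros of the sine,
    and m then goes to infinity. *)
Lemma prob_eq_of_cos (P Q : probability Rd R) :
  (forall h c, \int[P]_x (cos (inner h x + c))%:E =
      \int[Q]_x (cos (inner h x + c))%:E)%E ->
  forall B, measurable B -> P B = Q B.
Proof.
move=> PQ; apply: measure_eq_orthant => I a.
pose e i : 'cV[R]_d := delta_mx i 0.
(* The division brings u into (-pi, pi) for large m, where the sine has the sign of its argument;
   the shift 1/(m+1) puts the boundary x_i = a_i on the positive side. *)
pose u (m : nat) i (x : Rd) : R := (x i 0 - a i + m.+1%:R^-1) / m.+1%:R.
have innere i x : inner (e i) x = x i 0.
  rewrite /inner (bigD1 i)//= big1; last by move=> j ji; rewrite mxE (negbTE ji) mul0r.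
  by rewrite mxE !eqxx mul1r addr0.
have u_trig m i : trig_poly (fun x => sin (u m i x)).
  rewrite (_ : (fun x => _) = fun x =>
    cos (inner (m.+1%:R^-1 *: e i) x + ((- a i + m.+1%:R^-1) / m.+1%:R - pi / 2))).
    exact: trig_cos.
  apply/funext => x; rewrite addrA cosBpihalf innerZl innere; congr sin.
  by rewrite /u [_^-1 * x _ _]mulrC -mulrDl addrA.
have sin1 (y : R) : `|sin y| <= 1 by rewrite ler_norml sin_geN1 sin_le1.
have it1 n (y : R) : `|y| <= 1 -> `|iter n (@cubic_step R) y| <= 1.
  by move=> y1; elim: n => // n IH; apply: cubic_step_bound.
have half1 (y : R) : `|y| <= 1 -> `|(1 + y) / 2| <= 1.
  by rewrite !ler_norml => /andP[? ?]; apply/andP; split; lra.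
have prod1 (f : 'I_d -> R) : (forall i, `|f i| <= 1) -> `|\prod_(i | I i) f i| <= 1.
  by move=> f1; rewrite normr_prod; apply: prodr_ile1 => i _; rewrite normr_ge0/=.
pose F (g : R -> R) m (x : Rd) : R := \prod_(i | I i) ((1 + g (sin (u m i x))) / 2).
have F_agree m n : agree P Q (F (iter n (@cubic_step R)) m).
  apply: trig_agree => //.
    apply: trig_prod => i; under eq_fun do rewrite mulrC.
    apply: trig_scale; apply: trig_add; first exact: trig_cst.
    exact: trig_iter_cubic.
  by move=> x; apply: prod1 => i; apply: half1; apply: it1.
have cvg_F m x : F (iter n (@cubic_step R)) m x @[n --> \oo] --> F Num.sg m x.
  apply: (@cvg_big R 'I_d *%R 1 I (@mul_continuous R) nat \oo (index_enum _)
    (fun i n => (1 + iter n (@cubic_step R) (sin (u m i x))) / 2)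
    (fun i => (1 + Num.sg (sin (u m i x))) / 2)).
  move=> i _; apply: cvgM; last exact: cvg_cst.
  by apply: cvgD; [exact: cvg_cst|exact: cubic_step_cvg_sg].
have sg_agree m : agree P Q (F Num.sg m).
  exact: agree_cvg (F_agree m) (cvg_F m).
have [mI _ IE] : agree P Q (\1_(orthant I a)).
  apply: agree_cvg sg_agree _ => x.
  rewrite indicE (_ : (x \in orthant I a)%:R = \prod_(i | I i) (a i <= x i 0)%R%:R);
    last first.
    have [xa|/negP xa] := boolP (x \in orthant I a).
      rewrite big1// => i Ii; move: xa; rewrite inE => /(_ i Ii) ->//.
    apply/esym/eqP/prodf_eq0.
    have [i Ii ai] : exists2 i, I i & ~ (a i <= x i 0)%R.
      apply: contrapT => h; apply: xa; rewrite inE => i Ii.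
      by apply: contrapT => ai; apply: h; exists i.
    by exists i => //; move/negP/negbTE : ai => ->.
  apply: (@cvg_big R 'I_d *%R 1 I (@mul_continuous R) nat \oo (index_enum _)
    (fun i m => (1 + Num.sg (sin (u m i x))) / 2)
    (fun i => (a i <= x i 0)%R%:R)).
  move=> i _; apply: cvg_near_cst.
  have two_lt_pi : 2 <= pi :> R by exact: pi_ge2.
  have [ai|ai] := leP (a i) (x i 0).
    near=> m.
    have u0 : 0 < u m i x.
      by rewrite /u divr_gt0// ltr_wpDl ?subr_ge0// invr_gt0.
    have u1 : u m i x < pi.
      rewrite /u ltr_pdivrMr//.
      apply: (@le_lt_trans _ _ (x i 0 - a i + 1)).
        by rewrite lerD2l invf_le1 ?ler1n.
      apply: (@lt_le_trans _ _ (2 * m.+1%:R)); last by rewrite ler_wpM2r.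
      rewrite mulr_natl mulr2n ltr_leD ?ler1n//.
      apply: (@lt_trans _ _ m%:R); last by rewrite ltr_nat.
      by near: m; exact: nbhs_infty_gtr.
    rewrite gtr0_sg ?sin_gt0_pi ?u0//.
    by rewrite (_ : 1 + 1 = 2)// divff.
  have ai0 : 0 < a i - x i 0 by rewrite subr_gt0.
  near=> m.
  have u0 : u m i x < 0.
    rewrite /u pmulr_llt0 ?invr_gt0// addrC -ltrBrDr sub0r opprB.
    by near: m; exact: (near_infty_natSinv_lt (PosNum ai0)).
  have u1 : - pi < u m i x.
    rewrite /u ltr_pdivlMr// mulNr.
    apply: (@lt_le_trans _ _ (x i 0 - a i)); last by rewrite lerDl.
    rewrite -ltrNl opprB; apply: (@lt_le_trans _ _ m%:R).
      by near: m; exact: nbhs_infty_gtr.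
    apply: (@le_trans _ _ (1 * m.+1%:R)); first by rewrite mul1r ler_nat.
    by rewrite ler_wpM2r// (le_trans _ two_lt_pi)// ler1n.
  rewrite ltr0_sg; first by rewrite subrr mul0r.
  by rewrite -oppr_gt0 -sinN sin_gt0_pi// oppr_gt0 u0/= ltrNl.
move: IE; rewrite !integral_indic//; last 2 first.
  exact: measurable_orthant.
  exact: measurable_orthant.
by rewrite !setIT.
Unshelve. all: by end_near. Qed.

End trigonometric_determinacy.

(** * Independence *)

Definition mfun_of (d1 d2 : measure_display) (T1 : measurableType d1)
    (T2 : measurableType d2) (f : T1 -> T2) (mf : measurable_fun setT f) : {mfun T1 >->
      T2} :=
  HB.pack f (isMeasurableFun.Build d1 d2 T1 T2 f mf).

Section independence.
Context {disp : measure_display} {Omega : measurableType disp} {R : realType}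
  {Pr : probability Omega R} {dV : measure_display} {V : measurableType dV}.

Lemma mutually_independent_sub (I J : finType) (f : J -> I) (Y : I -> {RV Pr >-> V}) :
  injective f -> mutually_independent Y -> mutually_independent (Y \o f).
Proof.
move=> fI iY A mA.
pose B i : set V := if [pick j | f j == i] is Some j then A j else setT.
have Bf j : B (f j) = A j.
  rewrite /B; case: pickP => [j' /eqP/fI ->//|/(_ j)]; by rewrite eqxx.
have mB i : measurable (B i) by rewrite /B; case: pickP.
have := iY B mB.
have -> : \bigcap_(i in [set: I]) Y i @^-1` B i = \bigcap_(j in [set:
    J]) (Y \o f) j @^-1` A j.
  apply/seteqP; split => w wB.
    by move=> j _; rewrite -Bf; exact: (wB (f j)).
  move=> i _; rewrite /B /preimage/=; case: pickP => [j /eqP <-|//].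
  exact: (wB j).
move=> ->; rewrite (bigID (fun i => i \in f @: [set: J]%SET))/=.
rewrite [X in (_ * X)%E]big1 ?mule1; last first.
  move=> i; rewrite /B; case: pickP => [j /eqP <-|_ _]; first by rewrite imset_f.
  by rewrite preimage_setT probability_setT.
rewrite big_imset/=; last by move=> ? ? _ _; exact: fI.
by apply: eq_big => [j|j _]; rewrite ?inE// Bf.
Qed.

Lemma mutually_independent_map (I : finType) (d' : measure_display) (W :
    measurableType d')
    (Y : I -> {RV Pr >-> V}) (Z : I -> {RV Pr >-> W}) (phi : I -> V -> W) :
  (forall i, measurable_fun setT (phi i)) -> (forall i w, Z i w = phi i (Y i w)) ->
  mutually_independent Y -> mutually_independent Z.
Proof.
move=> mphi ZY iY A mA.
have ZE i : Z i @^-1` A i = Y i @^-1` (phi i @^-1` A i).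
  by apply/seteqP; split => w; rewrite /preimage/= ZY.
under eq_bigcapr do rewrite ZE.
under [RHS]eq_bigr do rewrite ZE.
by apply: iY => i; rewrite -[X in measurable X]setTI; exact: mphi.
Qed.

Lemma mutually_independent_pair (I : finType) (Y : I -> {RV Pr >-> V}) (i j : I) (A B :
    set V) :
  mutually_independent Y -> i != j -> measurable A -> measurable B ->
  (Pr (Y i @^-1` A `&` Y j @^-1` B) = Pr (Y i @^-1` A) * Pr (Y j @^-1` B))%E.
Proof.
move=> iY ij mA mB.
pose C l : set V := if l == i then A else if l == j then B else setT.
have mC l : measurable (C l) by rewrite /C; case: eqP => // _; case: eqP.
have Ci : C i = A by rewrite /C eqxx.
have Cj : C j = B by rewrite /C eq_sym (negbTE ij) eqxx.
have := iY C mC.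
have -> : \bigcap_(l in [set: I]) Y l @^-1` C l = Y i @^-1` A `&` Y j @^-1` B.
  apply/seteqP; split => w wC.
    by split; [rewrite -Ci|rewrite -Cj]; apply: wC.
  move=> l _; rewrite /preimage /= /C; case: wC => wA wB.
  by case: eqP => [->//|_]; case: eqP => [->//|].
move=> ->; rewrite (bigD1 i)//= Ci; congr (_ * _)%E.
rewrite (bigD1 j) 1?eq_sym//= Cj big1 ?mule1// => l /andP[li lj].
by rewrite /C (negbTE li) (negbTE lj) preimage_setT probability_setT.
Qed.

Lemma mutually_independent_block (I J : finType) (S : I -> {RV Pr >-> V})
    (H : J -> {RV Pr >-> V}) (j : J) (A : I -> set V) (B : set V) :
  mutually_independent (join_families S H) ->
  (forall i, measurable (A i)) -> measurable B ->
  (Pr (H j @^-1` B `&` \bigcap_(i in [set: I]) (S i @^-1` A i)) =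
   Pr (H j @^-1` B) * Pr (\bigcap_(i in [set: I]) (S i @^-1` A i)))%E.
Proof.
move=> iSH mA mB.
have iS : mutually_independent S.
  by apply: (mutually_independent_sub (f := inl) _ iSH) => ? ? [].
pose C (s : I + J) : set V := match s with
  | inl i => A i | inr j' => if j' == j then B else setT end.
have mC s : measurable (C s) by case: s => [//|j'] /=; case: ifP.
have := iSH C mC.
have -> : \bigcap_(s in [set: I + J]) (join_families S H) s @^-1` C s =
    H j @^-1` B `&` \bigcap_(i in [set: I]) (S i @^-1` A i).
  apply/seteqP; split => w.
    move=> wC; split; first by have := wC (inr j) Logic.I; rewrite /preimage/= eqxx.
    by move=> i _; exact: (wC (inl i)).
  move=> [wB wA] [i|j'] _; first exact: wA.
  by rewrite /preimage/=; case: eqP => [->|].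
move=> ->; rewrite big_sumType/= iS// muleC; congr (_ * _)%E.
rewrite (bigD1 j)//= eqxx big1 ?mule1// => j' /negbTE ->.
by rewrite preimage_setT probability_setT.
Qed.

(* The sample space with the sigma-algebra generated by the family [S], which is
   the part of the randomness that [H] is independent of. *)
Definition rectangles (I : finType) (S : I -> {RV Pr >-> V}) : set (set Omega) :=
  [set E | exists2 A : I -> set V, (forall i, measurable (A i)) &
    E = \bigcap_(i in [set: I]) (S i @^-1` A i)].

Definition sub_space (I : finType) (S : I -> {RV Pr >-> V}) :=
  g_sigma_algebraType (rectangles S).

Section sub_space.
Context {I : finType} (S : I -> {RV Pr >-> V}).

Lemma rectangles_measurable : rectangles S `<=` measurable.
Proof.
move=> _ [A mA ->]; apply: fin_bigcap_measurable => // i _.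
exact: measurable_funPTI.
Qed.

Lemma measurable_to_sub_space : measurable_fun setT (id : Omega -> sub_space S).
Proof.
apply: (@measurability _ _ Omega (sub_space S) setT id (rectangles S)) => //.
by move=> _ [A SA <-]; rewrite setTI preimage_id; exact: rectangles_measurable.
Qed.

Lemma measurable_sub_space i : measurable_fun setT (S i : sub_space S -> V).
Proof.
move=> _ A mA; rewrite setTI; apply: sub_sigma_algebra.
exists (fun j => if j == i then A else setT); first by move=> j; case: eqP.
apply/seteqP; split => w; first by move=> wA j _; rewrite /preimage/=; case: eqP => [->|].
by move=> /(_ i Logic.I); rewrite /preimage/= eqxx.
Qed.

Lemma measurable_sub_space_snd (dU : measure_display) (U : measurableType dU) i :
  measurable_fun setT (fun p : U * sub_space S => S i p.2).
Proof. exact: (measurableT_comp (measurable_sub_space i) (@measurable_snd _ _ U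
  (sub_space S))). Qed.

(** The law of w |-> (H w, w) on V times [sub_space S] is the product measure: independence gives
    this on rectangles, and two uniqueness arguments extend it. The second component is w itself,
    seen only through the samples. *)
Lemma independent_fubini (H : {RV Pr >-> V}) (D : set (V * sub_space S)) :
  (forall (A : I -> set V) (B : set V), (forall i, measurable (A i)) -> measurable B ->
    (Pr (H @^-1` B `&` \bigcap_(i in [set: I]) (S i @^-1` A i)) =
     Pr (H @^-1` B) * Pr (\bigcap_(i in [set: I]) (S i @^-1` A i)))%E) ->
  measurable D ->
  Pr [set w | D (H w, w)] = (\int[distribution Pr H]_v Pr [set w | D (v, w)])%E.
Proof.
move=> HS mD.
have mpair : measurable_fun setT (fun w : Omega => (H w, (w : sub_space S))).
  by apply: measurable_fun_pair => //; exact: measurable_to_sub_space.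
pose P2 := distribution Pr (mfun_of measurable_to_sub_space).
pose P12 := distribution Pr (mfun_of mpair).
transitivity ((distribution Pr H \x P2)%E D); last first.
  apply: eq_integral => v _ /=; rewrite /P2 /distribution /pushforward/=.
  by congr (Pr _); apply/seteqP; split => w; rewrite /preimage /= /xsection/= inE.
apply/esym; apply: (@product_measure_unique _ _ _ _ _ (distribution Pr H) P2 P12) => //
  B E mB mE.
have mHB : measurable (H @^-1` B) by exact: measurable_funPTI.
pose r : {nonneg R} := NngNum (fine_ge0 (measure_ge0 Pr (H @^-1` B))).
have rE : (r%:num)%:E = Pr (H @^-1` B) by rewrite fineK// fin_num_measure.
(* With B fixed, Pr (E and H in B) and Pr (H in B) * Pr E are finite measures in E that agree on the
   rectangles. *)
have key := @g_sigma_algebra_measure_unique _ R Omega (rectangles S)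
  rectangles_measurable (fun=> setT) _ _ (mrestr Pr mHB) (mscale r Pr).
have : mrestr Pr mHB E = mscale r Pr E.
  apply: key => //.
  - by move=> _; exists (fun=> setT) => //; apply/seteqP; split => w.
  - exact: bigcup_const.
  - move=> _ _ [A mA ->] [C mC ->]; exists (fun i => A i `&` C i).
      by move=> i; exact: measurableI.
    apply/seteqP; split => w; first by move=> [wA wC] i _; split; [exact: wA|exact: wC].
    by move=> wAC; split => i _; have [] := wAC i Logic.I.
  - move=> _ [A mA ->]; set F := \bigcap_(i in _) _.
    transitivity (Pr (F `&` H @^-1` B)); first by [].
    by rewrite setIC HS// -rE.
  - move=> _; rewrite (@le_lt_trans _ _ (Pr (setT `&` H @^-1` B)))// setTI.
    by rewrite (le_lt_trans (probability_le1 _ _)) ?ltry.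
move=> h; transitivity (Pr (E `&` H @^-1` B)); first by rewrite setIC.
by rewrite [LHS]h; transitivity ((r%:num)%:E * Pr E)%E; [|rewrite rE].
Qed.

Lemma measurable_section (D : set (V * sub_space S)) : measurable D ->
  measurable_fun setT (fun v => Pr [set w | D (v, w)]).
Proof.
move=> mD; apply: (eq_measurable_fun
    (distribution Pr (mfun_of measurable_to_sub_space) \o xsection D)).
  move=> v _ /=; rewrite /distribution /pushforward/=.
  by congr (Pr _); apply/seteqP; split => w; rewrite /preimage /= /xsection/= inE.
exact: measurable_fun_xsection.
Qed.

End sub_space.
End independence.

(** * Moments and Taylor expansions of trigonometric integrals *)

Section moments.
Context {R : realType} {d : nat}.
Notation Rd := (borelRd R d).

Lemma measurable_innerl (h : 'cV[R]_d) : measurable_fun setT (inner h : Rd -> R).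
Proof. exact: (measurable_inner (@measurable_cst _ _ Rd Rd setT h) (@measurable_id _ Rd
  setT)). Qed.

Lemma enorm_ge0 (x : 'cV[R]_d) : 0 <= enorm x.
Proof. exact: sqrtr_ge0. Qed.

(** The [+ 1] keeps the scale positive even at h = 0, as the weights of Bang's argument must be. *)
Definition sumnorm (h : 'cV[R]_d) : R := \sum_i `|h i 0| + 1.

Lemma sumnorm_gt0 h : 0 < sumnorm h.
Proof. by rewrite ltr_wpDl// sumr_ge0. Qed.

Lemma inner_le_enorm (h x : 'cV[R]_d) : `|inner h x| <= sumnorm h * enorm x.
Proof.
have xi i : `|x i 0| <= enorm x.
  rewrite -sqrtr_sqr ler_wsqrtr// /inner (bigD1 i)//= expr2 lerDl.
  by apply: sumr_ge0 => j _; rewrite -expr2 sqr_ge0.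
apply: (@le_trans _ _ (\sum_i `|h i 0| * enorm x)).
  apply: (le_trans (ler_norm_sum _ _ _)); apply: ler_sum => i _.
  by rewrite normrM ler_wpM2l.
by rewrite -mulr_suml ler_wpM2r ?enorm_ge0// lerDl.
Qed.

Lemma Rintegral_sum (dT : measure_display) (T : measurableType dT)
    (P : {measure set T -> \bar R}) (n : nat) (F : 'I_n -> T -> R) :
  (forall i, P.-integrable setT (EFin \o F i)) ->
  \int[P]_x (\sum_(i < n) F i x) = \sum_(i < n) \int[P]_x F i x.
Proof.
elim: n F => [|n IH] F iF.
  under eq_Rintegral do rewrite big_ord0.
  by rewrite big_ord0 Rintegral_cst// mul0r.
under eq_Rintegral do rewrite big_ord_recl.
rewrite RintegralD//; last first.
  rewrite (_ : _ \o _ = fun x => (\sum_(i < n) (F (lift ord0 i) x)%:E)%E); last first.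
    by apply/funext => x; rewrite /= sumEFin.
  by apply: integrable_sum => // i _; exact: iF.
by rewrite big_ord_recl IH.
Qed.

Context (P : probability Rd R).
Hypothesis Pfin : forall N, (1 <= N)%N -> (abs_moment P N < +oo)%E.

Lemma abs_moment0 : abs_moment P 0 = 1%E.
Proof.
rewrite /abs_moment; under eq_integral do rewrite expr0.
by rewrite integral_cst// mul1e; exact: probability_setT.
Qed.

Lemma measurable_enormX N : measurable_fun setT (fun x : Rd => enorm x ^+ N).
Proof. exact: (measurable_funX N (@measurable_enorm R d)). Qed.

Lemma integrable_enormX N : P.-integrable setT (fun x => (enorm x ^+ N)%:E).
Proof.
apply/integrableP; split; first by apply/measurable_EFinP; exact: measurable_enormX.
under eq_integral => x _ do rewrite gee0_abs ?lee_fin ?exprn_ge0 ?enorm_ge0//.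
case: N => [|N]; last exact: Pfin.
by rewrite -/(abs_moment P 0) abs_moment0 ltry.
Qed.

Lemma abs_moment_fin N : abs_moment P N = (\int[P]_x (enorm x ^+ N))%:E.
Proof.
rewrite /Rintegral fineK//; exact: integrable_fin_num (integrable_enormX N).
Qed.

Lemma integrable_enorm_bound (f : Rd -> R) (K : R) (N : nat) :
  measurable_fun setT f -> (forall x, `|f x| <= K * enorm x ^+ N) ->
  P.-integrable setT (EFin \o f).
Proof.
move=> mf fK.
apply: (@le_integrable _ _ _ _ setT _ (EFin \o f) (fun x => (K%:E * (enorm x ^+
  N)%:E)%E)) => //.
- exact/measurable_EFinP.
- by move=> x _; rewrite -EFinM !abse_EFin lee_fin (le_trans (fK x))// ler_norm.
- by apply: integrableZl => //; exact: integrable_enormX.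
Qed.

Lemma Rintegral_enorm_bound (f : Rd -> R) (K : R) (N : nat) :
  measurable_fun setT f -> (forall x, `|f x| <= K * enorm x ^+ N) ->
  `|\int[P]_x f x| <= K * \int[P]_x (enorm x ^+ N).
Proof.
move=> mf fK; have fi := integrable_enorm_bound mf fK.
rewrite -RintegralZl//; last exact: integrable_enormX.
apply: (le_trans (le_normr_Rintegral _ fi)) => //.
apply: le_Rintegral => //.
  exact: integrable_norm.
by rewrite /comp; under eq_fun do rewrite EFinM; apply: integrableZl => //;
  exact: integrable_enormX.
Qed.

(** Cauchy-Schwarz, from the nonnegative quadratic form in (s, t) that integrates ||x||^n (s + t
    ||x||)^2: at (c, -b) its value is c (a c - b^2). *)
Lemma enorm_moment_log_convex n :
  (\int[P]_x (enorm x ^+ n.+1)) ^+ 2 <=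
  \int[P]_x (enorm x ^+ n) * \int[P]_x (enorm x ^+ n.+2).
Proof.
set a := \int[P]_x (enorm x ^+ n); set b := \int[P]_x (enorm x ^+ n.+1).
set c := \int[P]_x (enorm x ^+ n.+2).
have c0 : 0 <= c by apply: Rintegral_ge0 => x _; rewrite exprn_ge0 ?enorm_ge0.
have key (s t : R) : 0 <= s ^+ 2 * a + (2 * s * t) * b + t ^+ 2 * c.
  have -> : s ^+ 2 * a + (2 * s * t) * b + t ^+ 2 * c =
      \int[P]_x (enorm x ^+ n * (s + t * enorm x) ^+ 2).
    have i N (k : R) : P.-integrable setT (EFin \o (fun x => k * enorm x ^+ N)).
      by rewrite /comp; under eq_fun do rewrite EFinM; apply: integrableZl => //;
        exact: integrable_enormX.
    rewrite -!RintegralZl//; try exact: integrable_enormX.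
    rewrite -RintegralD// -RintegralD//.
      by apply: eq_Rintegral => x _; rewrite !exprS; ring.
    exact: (integrableD measurableT (i n (s ^+ 2)) (i n.+1 (2 * s * t))).
  by apply: Rintegral_ge0 => x _; rewrite mulr_ge0 ?sqr_ge0 ?exprn_ge0 ?enorm_ge0.
have [c00|cpos] := leP c 0.
  have {}c0 : c = 0 by apply/le_anti; rewrite c00.
  have a0 : 0 <= a by apply: Rintegral_ge0 => x _; rewrite exprn_ge0 ?enorm_ge0.
  have b0 : 0 <= b by apply: Rintegral_ge0 => x _; rewrite exprn_ge0 ?enorm_ge0.
  rewrite c0 mulr0.
  have [->|bn] := eqVneq b 0; first by rewrite expr0n.
  have bp : 0 < b by rewrite lt_neqAle eq_sym bn.
  (* With c = 0 and b != 0 the form is affine in t, and this t gives it the value -1. *)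
  have := key 1 (- (a + 1) / (2 * b)); rewrite c0 mulr0 addr0 expr1n !mul1r !mulr1.
  have -> : 2 * (- (a + 1) / (2 * b)) * b = - (a + 1) by field; rewrite gt_eqF.
  lra.
have := key c (- b).
have -> : c ^+ 2 * a + 2 * c * - b * b + (- b) ^+ 2 * c = c * (a * c - b ^+ 2) by ring.
by rewrite pmulr_rge0// subr_ge0.
Qed.

(** Formally the n-th derivative in t of the integral of cos (c + t <h,x>), each derivative being a
    phase shift by pi/2. *)
Definition cos_moment (h : 'cV[R]_d) (c : R) (n : nat) (t : R) : R :=
  \int[P]_x (inner h x ^+ n * cos (c + n%:R * (pi / 2) + t * inner h x)).

Lemma measurable_cos_moment h c n t :
  measurable_fun setT (fun x : Rd => inner h x ^+ n * cos (c + t * inner h x)).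
Proof.
have mh := measurable_innerl h.
apply: measurable_funM; first exact: (measurable_funX n mh).
apply: (measurableT_comp (continuous_measurable_fun (@continuous_cos R))).
by apply: measurable_funD => //; exact: measurable_funM.
Qed.

Lemma innerX_le h x n : `|inner h x ^+ n| <= sumnorm h ^+ n * enorm x ^+ n.
Proof.
by rewrite normrX -exprMn lerXn2r ?nnegrE ?mulr_ge0 ?enorm_ge0 ?(ltW (sumnorm_gt0 h))//
  inner_le_enorm.
Qed.

Lemma innerX_cos_le h c n t x :
  `|inner h x ^+ n * cos (c + t * inner h x)| <= sumnorm h ^+ n * enorm x ^+ n.
Proof.
rewrite normrM -[leRHS]mulr1 ler_pM// ?innerX_le//.
by rewrite ler_norml cos_geN1 cos_le1.
Qed.

(** The pointwise bound [cosD_taylor], at increment s <h,x>, is multiplied by <h,x>^n and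
    integrated; <h,x>^(n+m) is then bounded by the absolute moment. *)
Lemma cos_moment_taylor h c n m t s :
  `|cos_moment h c n (t + s) -
    \sum_(j < m) cos_moment h c (n + j) t * (s ^+ j / j`!%:R)| <=
  sumnorm h ^+ (n + m) * (\int[P]_x (enorm x ^+ (n + m))) * (`|s| ^+ m / m`!%:R).
Proof.
pose th (x : Rd) := c + n%:R * (pi / 2) + t * inner h x.
pose F (j : nat) (x : Rd) : R := inner h x ^+ (n + j) *
  cos (c + (n + j)%:R * (pi / 2) + t * inner h x) * (s ^+ j / j`!%:R).
have iF j : P.-integrable setT (EFin \o F j).
  apply: (@integrable_enorm_bound _ (sumnorm h ^+ (n + j) * `|s ^+ j / j`!%:R|) (n + j)).
    by apply: measurable_funM => //; exact: measurable_cos_moment.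
  by move=> x; rewrite normrM mulrAC ler_wpM2r// innerX_cos_le.
have iG : P.-integrable setT (EFin \o (fun x => inner h x ^+ n *
    cos (c + n%:R * (pi / 2) + (t + s) * inner h x))).
  apply: (@integrable_enorm_bound _ (sumnorm h ^+ n) n); first exact:
    measurable_cos_moment.
  by move=> x; rewrite innerX_cos_le.
have iS : P.-integrable setT (EFin \o (fun x => \sum_(j < m) F j x)).
  rewrite (_ : _ \o _ = fun x => (\sum_(i < m) (F i x)%:E)%E); last first.
    by apply/funext => x; rewrite /= sumEFin.
  by apply: integrable_sum => // i _; exact: iF.
have -> : cos_moment h c n (t + s) -
    \sum_(j < m) cos_moment h c (n + j) t * (s ^+ j / j`!%:R) =
    \int[P]_x (inner h x ^+ n * cos (c + n%:R * (pi / 2) + (t + s) * inner h x) -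
      \sum_(j < m) F j x).
  rewrite RintegralB// Rintegral_sum//; congr (_ - _); apply: eq_bigr => j _.
  rewrite /F RintegralZr//.
  apply: (@integrable_enorm_bound _ (sumnorm h ^+ (n + j)) (n + j)); first exact:
    measurable_cos_moment.
  by move=> x; rewrite innerX_cos_le.
rewrite mulrAC; apply: Rintegral_enorm_bound.
  apply: measurable_funB; first exact: measurable_cos_moment.
  by apply: measurable_sum => j; apply: measurable_funM => //;
    exact: measurable_cos_moment.
move=> x.
have -> : inner h x ^+ n * cos (c + n%:R * (pi / 2) + (t + s) * inner h x) - \sum_(j <
    m) F j x =
  inner h x ^+ n * (cos (th x + s * inner h x) -
    \sum_(j < m) cos (th x + j%:R * (pi / 2)) * ((s * inner h x) ^+ j / j`!%:R)).
  rewrite mulrBr; congr (_ * cos _ - _); first by rewrite /th [(t + s) * _]mulrDl addrA.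
  rewrite [RHS]mulr_sumr; apply: eq_bigr => j _; rewrite /F /th natrD exprD exprMn.
  rewrite (_ : c + (n%:R + j%:R) * (pi / 2) + t * inner h x =
    c + n%:R * (pi / 2) + t * inner h x + j%:R * (pi / 2));
      last by rewrite [(_ + j%:R) * _]mulrDl [c + (_ + _)]addrA [LHS]addrAC.
  by move: (cos _) (j`!%:R^-1) => C f; ring.
rewrite normrM.
apply: (@le_trans _ _ (`|inner h x ^+ n| * (`|s * inner h x| ^+ m / m`!%:R))).
  by rewrite ler_wpM2l// cosD_taylor.
have -> : `|inner h x ^+ n| * (`|s * inner h x| ^+ m / m`!%:R) =
    `|inner h x ^+ (n + m)| * (`|s| ^+ m / m`!%:R).
  rewrite !normrX normrM exprMn exprD.
  by move: (m`!%:R^-1) (`|inner h x|) (`|s|) => f y z; ring.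
by rewrite mulrAC ler_wpM2r ?divr_ge0 ?exprn_ge0// innerX_le.
Qed.

End moments.

(** * Determinacy of the moment problem *)

Lemma fin_num_poweR_series (R : realType) (m : nat -> R) :
  (forall n, 0 < m n) ->
  (\sum_(1 <= N <oo) ((m N)%:E `^ (- N%:R^-1)%R) = +oo)%E ->
  forall A : R, exists N, A <= \sum_(n < N) m n.+1 `^ (- n.+1%:R^-1).
Proof.
move=> m0 moo A; apply: contrapT => hA.
suff : (\sum_(1 <= N <oo) ((m N)%:E `^ (- N%:R^-1)%R) <= A%:E)%E by rewrite moo.
apply: lime_le; first by apply: is_cvg_nneseries => n _ _;
  rewrite poweR_EFin lee_fin powR_ge0.
apply: nearW => -[|N]; rewrite leNgt; apply/negP => AN; apply: hA;
  [exists 0%N|exists N]; move: AN.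
  by rewrite big_geq// big_ord0 lte_fin => /ltW.
rewrite big_add1 [N.+1.-1]/= big_mkord (eq_bigr (fun n :
  'I_N => (m n.+1 `^ (- n.+1%:R^-1))%:E)).
  by rewrite sumEFin lte_fin => /ltW.
by move=> n _; rewrite poweR_EFin.
Qed.

Section moment_problem.
Context {R : realType} {d : nat}.
Notation Rd := (borelRd R d).
Context (P Q : probability Rd R).
Hypothesis Pfin : forall N, (1 <= N)%N -> (abs_moment P N < +oo)%E.
Hypothesis QP : forall N, (abs_moment Q N <= abs_moment P N)%E.

Let Qfin N : (1 <= N)%N -> (abs_moment Q N < +oo)%E.
Proof. by move=> N1; exact: le_lt_trans (QP N) (Pfin N1). Qed.

(** At t = 0 the cosine in [cos_moment] is a constant, so all derivatives of the difference vanish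
    there because the moments of <h,x> agree. Bang's argument is then read at t = 1. *)
Lemma cos_integral_eq_of_moments :
  (forall N, 0 < \int[P]_x (enorm x ^+ N)) ->
  (\sum_(1 <= N <oo) (abs_moment P N `^ (- N%:R^-1)%R) = +oo)%E ->
  (forall N (h : 'cV[R]_d), \int[P]_x (inner h x ^+ N) = \int[Q]_x (inner h x ^+ N)) ->
  forall (h : 'cV[R]_d) c, \int[P]_x cos (inner h x + c) = \int[Q]_x cos (inner h x + c).
Proof.
move=> mpos carl meq h c.
pose m N := \int[P]_x (enorm x ^+ N).
have m0 N : 0 < m N by exact: mpos.
have QPm N : \int[Q]_x (enorm x ^+ N) <= m N.
  by rewrite -lee_fin -(abs_moment_fin Pfin) -(abs_moment_fin Qfin).
have div := carleman_ratio_diverges mpos.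
have {div} div : forall A : R, exists N, A <= \sum_(n < N) m n / m n.+1.
  apply: div; last first.
    apply: (@fin_num_poweR_series _ m) => //; rewrite -carl.
    by apply: eq_eseriesr => N _; rewrite (abs_moment_fin Pfin).
  by apply: EFin_inj; rewrite -(abs_moment_fin Pfin) abs_moment0.
pose C := sumnorm h.
have C0 : 0 < C by exact: sumnorm_gt0.
(* The factor 2 counts the remainders of P and Q, both bounded by the moments of P. Passing from m
   to M divides the ratios by C, which preserves log-convexity and divergence. *)
pose M n := 2 * (C ^+ n * m n).
pose f n t := cos_moment P h c n t - cos_moment Q h c n t.
have f0 n : f n 0 = 0.
  rewrite /f /cos_moment; apply/eqP; rewrite subr_eq0; apply/eqP.
  under eq_Rintegral do rewrite mul0r addr0.
  under [RHS]eq_Rintegral do rewrite mul0r addr0.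
  have i (S : probability Rd R) (Sfin : forall N, (1 <= N)%N ->
      (abs_moment S N < +oo)%E) :
      S.-integrable setT (EFin \o (fun x => inner h x ^+ n)).
    apply: (integrable_enorm_bound Sfin (K := C ^+ n) (N := n)); last by move=> x;
      exact: innerX_le.
    exact: (measurable_funX n (measurable_innerl h)).
  by rewrite !RintegralZr ?meq//; exact: i.
have fx : f 0%N 1 = 0.
  apply: (bang_vanishing (M := M)) => //.
  - by move=> n; rewrite /M mulr_gt0// mulr_gt0// exprn_gt0.
  - move=> n; rewrite /M.
    have := enorm_moment_log_convex Pfin n; rewrite -/(m _) -/(m _) -/(m _) => lc.
    rewrite [leLHS](_ : _ = 4 * C ^+ n.+1 ^+ 2 * m n.+1 ^+ 2); last by ring.
    rewrite [leRHS](_ : _ = 4 * C ^+ n.+1 ^+ 2 * (m n * m n.+2));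
      last by rewrite !exprS; ring.
    by rewrite ler_wpM2l// mulr_ge0 ?sqr_ge0.
  - move=> A; have [N AN] := div (C * A); exists N.
    rewrite -(ler_pM2l C0) mulr_sumr (le_trans AN)// ler_sum// => i _.
    rewrite le_eqVlt; apply/orP; left; apply/eqP; rewrite /M exprS.
    have Ci : C ^+ i != 0 by rewrite expf_neq0// gt_eqF.
    have mi : m i.+1 != 0 by rewrite gt_eqF.
    by field; rewrite Ci mi gt_eqF.
  - move=> n k t s.
    pose T (S : probability Rd R) := cos_moment S h c n (t + s) -
      \sum_(j < k) cos_moment S h c (n + j) t * (s ^+ j / j`!%:R).
    have -> : f n (t + s) - \sum_(j < k) f (n + j)%N t * (s ^+ j / j`!%:R) = T P - T Q.
      rewrite /f; under eq_bigr do rewrite mulrBl.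
      have alg (a b x y : R) : (a - b) - (x - y) = (a - x) - (b - y) by ring.
      by rewrite sumrB; exact: alg.
    rewrite (le_trans (ler_normB _ _))//.
    have p : 0 <= `|s| ^+ k / k`!%:R by rewrite divr_ge0// exprn_ge0.
    rewrite [leRHS](_ : _ = C ^+ (n + k) * m (n + k)%N * (`|s| ^+ k / k`!%:R) +
      C ^+ (n + k) * m (n + k)%N * (`|s| ^+ k / k`!%:R)); last first.
      by rewrite /M; move: (_ / k`!%:R) => z; ring.
    rewrite lerD ?(cos_moment_taylor Pfin)//.
    rewrite (le_trans (cos_moment_taylor Qfin _ _ _ _ _ _))//.
    by rewrite ler_wpM2r// ler_wpM2l ?exprn_ge0// ltW.
have E (S : probability Rd R) : cos_moment S h c 0 1 = \int[S]_x cos (inner h x + c).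
  by apply: eq_Rintegral => x _; rewrite expr0 mul1r mul0r addr0 mul1r addrC.
by apply/eqP; rewrite -subr_eq0 -!E; apply/eqP.
Qed.

Lemma moment_difference_linewise N :
  linewise_polynomial (fun h : 'cV[R]_d =>
    \int[P]_x (inner h x ^+ N) - \int[Q]_x (inner h x ^+ N)).
Proof.
have pol (S : probability Rd R) (Sfin : forall N, (1 <= N)%N ->
    (abs_moment S N < +oo)%E) :
    linewise_polynomial (fun h : 'cV[R]_d => \int[S]_x (inner h x ^+ N)).
  move=> a v.
  have i j : S.-integrable setT (EFin \o (fun x => inner a x ^+ (N - j) * inner v x ^+
      j)).
    apply: (integrable_enorm_bound Sfin (K := sumnorm a ^+ (N - j) * sumnorm v ^+ j) (N
      := (N - j + j)%N)).
      by apply: measurable_funM; apply: measurable_funX; exact: measurable_innerl.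
    by move=> x; rewrite normrM exprD mulrACA ler_pM// innerX_le.
  exists (\sum_(j < N.+1) (('C(N, j)%:R * \int[S]_x (inner a x ^+ (N - j) * inner v x
    ^+ j))%:P * 'X^j)).
  move=> t; rewrite horner_sum.
  transitivity (\int[S]_x (\sum_(j < N.+1) 'C(N, j)%:R * t ^+ j * (inner a x ^+ (N - j)
    * inner v x ^+ j))).
    apply: eq_Rintegral => x _; rewrite innerDl innerZl exprDn; apply: eq_bigr => j _.
    by rewrite exprMn -mulr_natl; ring.
  rewrite (Rintegral_sum (F := fun (j : 'I_N.+1) (x :
    Rd) => 'C(N, j)%:R * t ^+ j * (inner a x ^+ (N - j) * inner v x ^+ j))).
    apply: eq_bigr => j _; rewrite RintegralZl ?hornerE//; first by rewrite mulrAC.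
  move=> j; rewrite /comp; under eq_fun do rewrite EFinM.
  by apply: integrableZl => //; exact: i.
move=> a v; have [p pE] := pol P Pfin a v; have [q qE] := pol Q Qfin a v.
by exists (p - q) => t; rewrite pE qE hornerD hornerN.
Qed.

Lemma moments_differ :
  (forall N, 0 < \int[P]_x (enorm x ^+ N)) ->
  (\sum_(1 <= N <oo) (abs_moment P N `^ (- N%:R^-1)%R) = +oo)%E ->
  ~ (forall B, measurable B -> P B = Q B) ->
  exists N (h : 'cV[R]_d), \int[P]_x (inner h x ^+ N) - \int[Q]_x (inner h x ^+ N) != 0.
Proof.
move=> mpos carl PQ; apply: contrapT => hN; apply: PQ; apply: prob_eq_of_cos => h c.
have i (S : probability Rd R) : S.-integrable setT (EFin \o (fun x :
    Rd => cos (inner h x + c))).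
  apply: (bounded_integrable (B := 1)); last by move=> x;
    rewrite ler_norml cos_geN1 cos_le1.
  apply: (measurableT_comp (continuous_measurable_fun (@continuous_cos R))).
  by apply: measurable_funD => //; exact: measurable_innerl.
have e : \int[P]_x cos (inner h x + c) = \int[Q]_x cos (inner h x + c).
  apply: cos_integral_eq_of_moments => // N h'; apply/eqP; rewrite -subr_eq0.
  by apply: contrapT => /negP hh; apply: hN; exists N, h'.
rewrite -[LHS]fineK; last exact: integrable_fin_num (i P).
by rewrite -[RHS]fineK; [congr EFin|exact: integrable_fin_num (i Q)].
Qed.

End moment_problem.

(** * Laws on the line and moments of projections *)

(** Rational thresholds are enough because they are dense; their countability later makes the set of
    separating directions Borel. *)
Lemma prob_eq_rat_rays (R : realType) (mu nu : probability R R) :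
  (forall q : rat, mu `]-oo, ratr q]%classic = nu `]-oo, ratr q]%classic) ->
  forall B, measurable B -> mu B = nu B.
Proof.
move=> munu.
pose G : set (set R) := [set A | A = setT \/ exists q : rat, A = `]-oo, ratr q]%classic].
apply: (measure_unique G (fun=> setT)) => //.
- apply/seteqP; split; last first.
    apply: smallest_sub; first exact: sigma_algebra_measurable.
    by move=> _ [->|[q ->]]; [exact: measurableT|exact: measurable_itv].
  have mE : (measurable : set (set R)) = <<s @RGenOInfty.G R >> by exact:
      RGenOInfty.measurableE.
  rewrite mE.
  apply: smallest_sub; first exact: smallest_sigma_algebra.
  move=> _ [x ->].
  have -> : `]x, +oo[%classic = \bigcup_(q in [set q :
      rat | x < ratr q]) ~` `]-oo, (ratr q : R)]%classic.
    apply/seteqP; split => [y|y [q /= xq]] /=; rewrite !in_itv/= ?andbT.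
      by move=> /rat_in_itvoo[q]; rewrite in_itv/= => /andP[xq qy]; exists q => //=;
        apply/negP; rewrite in_itv/= -ltNge.
    by move=> /negP; rewrite -ltNge; exact: lt_trans.
  rewrite bigcup_mkcond.
  apply: (@countable_bigcupT_measurable _ (g_sigma_algebraType G)) => // q.
  case: ifPn => _; last exact: (@measurable0 _ (g_sigma_algebraType G)).
  apply: (@measurableC _ (g_sigma_algebraType G)); apply: sub_sigma_algebra.
  by right; exists q.
- move=> _ _ [->|[p ->]] [->|[q ->]]; rewrite ?setTI ?setIT; [by left|by right;
    exists q|by right; exists p|].
  right; exists (Num.min p q); apply/seteqP; split => y /=; rewrite !in_itv/=.
    by move=> [yp yq]; case: (leP p q).
  have [pq|/ltW qp] := leP p q; move=> yp; split => //; apply: (le_trans yp);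
      rewrite ler_rat//.
- by move=> _; left.
- exact: bigcup_const.
- by move=> _ [->|[q ->]]; [rewrite [LHS]probability_setT [RHS]probability_setT|exact:
    munu].
- by move=> _ /=; rewrite (le_lt_trans (probability_le1 mu measurableT))// ltry.
Qed.

Lemma moment_eq_of_rays (R : realType) (d : nat) (P Q : probability (borelRd R d) R)
    (h : 'cV[R]_d) (N : nat) :
  (forall N, (1 <= N)%N -> (abs_moment P N < +oo)%E) ->
  (forall N, (1 <= N)%N -> (abs_moment Q N < +oo)%E) ->
  (forall q : rat, P [set x | inner h x <= ratr q] = Q [set x | inner h x <= ratr q]) ->
  \int[P]_x (inner h x ^+ N) = \int[Q]_x (inner h x ^+ N).
Proof.
move=> Pfin Qfin PQ.
have E (S : probability (borelRd R d) R) (Sfin : forall N, (1 <= N)%N ->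
    (abs_moment S N < +oo)%E) :
    (\int[distribution S (mfun_of (measurable_innerl h))]_y (y ^+ N)%:E =
    \int[S]_x (inner h x ^+ N)%:E)%E.
  rewrite integral_distribution//.
    by apply/measurable_EFinP; exact: (measurable_funX N (@measurable_id _ R setT)).
  apply: (integrable_enorm_bound Sfin (K := sumnorm h ^+ N) (N := N));
    last by move=> x; exact: innerX_le.
  exact: (measurable_funX N (measurable_innerl h)).
rewrite /Rintegral -!E//; congr fine; apply: eq_measure_integral => A mA _.
by apply: prob_eq_rat_rays.
Qed.

(** * Empirical distribution functions *)

Section empirical.
Context {R : realType}.

Lemma ecdf_sum (n : nat) (y : 'I_n -> R) t :
  ecdf y t = (\sum_(i < n) (y i <= t)%R%:R) / n%:R.
Proof. by rewrite /ecdf -sum1_card natr_sum big_mkcond/=; congr (_ / _);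
  apply: eq_bigr => i _; rewrite inE; case: ifP. Qed.

Lemma ecdf_bounds (n : nat) (y : 'I_n -> R) t : 0 <= ecdf y t <= 1.
Proof.
rewrite /ecdf divr_ge0//=; case: n y => [|n] y; first by rewrite invr0 mulr0.
by rewrite ler_pdivrMr ?ltr0n// mul1r ler_nat (leq_trans (max_card _))// card_ord.
Qed.

Lemma ecdf_nondecreasing (n : nat) (y : 'I_n -> R) : {homo ecdf y : s t / s <= t}.
Proof.
move=> s t st; rewrite /ecdf ler_wpM2r ?invr_ge0// ler_nat subset_leq_card//.
by apply/fintype.subsetP => i; rewrite !inE => /le_trans; exact.
Qed.

Lemma two_sample_KS_le (n1 n2 : nat) (y : 'I_n1 -> R) (z : 'I_n2 -> R) (c : R) :
  (forall t, `|ecdf y t - ecdf z t| <= c) -> two_sample_KS y z <= c.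
Proof.
move=> yz; apply: ge_sup; first by exists `|ecdf y 0 - ecdf z 0|, 0.
by move=> _ [t _ <-].
Qed.

Lemma le_two_sample_KS (n1 n2 : nat) (y : 'I_n1 -> R) (z : 'I_n2 -> R) t :
  `|ecdf y t - ecdf z t| <= two_sample_KS y z.
Proof.
apply: ub_le_sup; last by exists t.
exists 1 => _ [s _ <-]; have := ecdf_bounds y s; have := ecdf_bounds z s.
by move=> /andP[? ?] /andP[? ?]; rewrite ler_norml; apply/andP; split; lra.
Qed.

Lemma ecdf_right_rat (n : nat) (y : 'I_n -> R) t :
  exists2 e, t < e & forall s, t <= s < e -> ecdf y s = ecdf y t.
Proof.
(* The next observation after t, up to which the step function is constant; t + 1 is the default
   when there is none, and a cap otherwise. *)
pose e := \big[Num.min/t + 1]_(i < n | t < y i) y i.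
exists e; first by apply: lt_bigmin; rewrite ?ltrDl.
move=> s /andP[ts se]; congr (_%:R / _); apply: eq_card => i; rewrite !inE.
apply/idP/idP => [ys|/le_trans]; last exact.
rewrite leNgt; apply/negP => ty; have : e <= y i by exact: bigmin_le_cond.
by rewrite leNgt (le_lt_trans ys se).
Qed.

(** Both step functions are constant on a short interval to the right of t, which contains a
    rational. The supremum thus becomes countable, whence measurability of the statistic. *)
Lemma lt_two_sample_KS (n1 n2 : nat) (y : 'I_n1 -> R) (z : 'I_n2 -> R) (c : R) :
  c < two_sample_KS y z <->
  exists q : rat, c < `|ecdf y (ratr q) - ecdf z (ratr q)|.
Proof.
split=> [|[q cq]]; last exact: (lt_le_trans cq (le_two_sample_KS _ _ _)).
move=> /sup_gt[]; first by exists `|ecdf y 0 - ecdf z 0|, 0.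
move=> _ [t _ <-] ct.
have [e1 te1 ye1] := ecdf_right_rat y t; have [e2 te2 ze2] := ecdf_right_rat z t.
have /rat_in_itvoo[q] : t < Num.min e1 e2 by rewrite lt_min te1.
rewrite in_itv/= lt_min => /andP[tq /andP[q1 q2]]; exists q.
by rewrite ye1 ?ze2// (ltW tq).
Qed.

Lemma measurable_ecdf (dU : measure_display) (U : measurableType dU) (n : nat)
    (f : 'I_n -> U -> R) t :
  (forall i, measurable_fun setT (f i)) ->
  measurable_fun setT (fun u => ecdf (f ^~ u) t).
Proof.
move=> mf; under eq_fun do rewrite ecdf_sum.
apply: measurable_funM => //; apply: measurable_sum => i.
rewrite (_ : (fun u => _) = \1_(f i @^-1` `]-oo, t])).
  by apply: measurable_indic; rewrite -[X in measurable X]setTI; exact: mf.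
apply/funext => u; rewrite indicE; congr (_%:R); congr nat_of_bool.
by apply/idP/idP; rewrite inE /preimage/= in_itv.
Qed.

Lemma measurable_ecdf_deviation (dU : measure_display) (U : measurableType dU) (n : nat)
    (f : 'I_n -> U -> R) t p delta :
  (forall i, measurable_fun setT (f i)) ->
  measurable [set u | delta <= `|ecdf (f ^~ u) t - p|].
Proof.
move=> mf; rewrite (_ : mkset _ =
    (fun u => `|ecdf (f ^~ u) t - p|) @^-1` `[delta, +oo[%classic); last first.
  by apply/seteqP; split => u; rewrite /preimage/= in_itv/= andbT.
have m : measurable_fun setT (fun u => `|ecdf (f ^~ u) t - p|).
  by apply: measurableT_comp => //; apply: measurable_funB => //; exact: measurable_ecdf.
by rewrite -[X in measurable X]setTI; exact: m.
Qed.

Lemma measurable_KS_gt (dU : measure_display) (U : measurableType dU) (n1 n2 : nat)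
    (f : 'I_n1 -> U -> R) (g : 'I_n2 -> U -> R) (c : R) :
  (forall i, measurable_fun setT (f i)) -> (forall i, measurable_fun setT (g i)) ->
  measurable [set u | c < two_sample_KS (f ^~ u) (g ^~ u)].
Proof.
move=> mf mg.
rewrite (_ : [set u | _] = \bigcup_(q : rat)
   ((fun u => `|ecdf (f ^~ u) (ratr q) - ecdf (g ^~ u) (ratr q)|) @^-1` `]c, +oo[));
     last first.
  apply/seteqP; split => u /=.
    by move=> /lt_two_sample_KS[q cq]; exists q => //=; rewrite in_itv/= andbT.
  by move=> [q _ /=]; rewrite in_itv/= andbT => cq; apply/lt_two_sample_KS; exists q.
apply: bigcupT_measurable_rat => q; rewrite -[X in measurable X]setTI.
have m : measurable_fun setT (fun u => `|ecdf (f ^~ u) (ratr q) - ecdf (g ^~ u) (ratr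
    q)|).
  by apply: measurableT_comp => //; apply: measurable_funB; exact: measurable_ecdf.
exact: m.
Qed.

(** With i the integer part of M * F t, monotonicity between grid points confines both a t and b t
    to the interval from (i-1)/M - delta to (i+1)/M + delta. *)
Lemma grid_bound (M : nat) (F a b : R -> R) (t_ : nat -> R) (delta : R) :
  (0 < M)%N -> 0 <= delta ->
  {homo F : s t / s <= t} -> (forall t, 0 <= F t <= 1) ->
  {homo a : s t / s <= t} -> (forall t, 0 <= a t <= 1) ->
  {homo b : s t / s <= t} -> (forall t, 0 <= b t <= 1) ->
  (forall i, (0 < i < M)%N -> F (t_ i) = i%:R / M%:R) ->
  (forall i, (0 < i < M)%N -> `|a (t_ i) - i%:R / M%:R| <= delta) ->
  (forall i, (0 < i < M)%N -> `|b (t_ i) - i%:R / M%:R| <= delta) ->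
  forall t, `|a t - b t| <= 2 / M%:R + 2 * delta.
Proof.
move=> M0 d0 Fm F01 am a01 bm b01 Ft at_ bt_ t.
have MR : 0 < M%:R :> R by rewrite ltr0n.
have MV : 0 < M%:R^-1 :> R by rewrite invr_gt0.
pose i := Num.truncn (M%:R * F t).
have /andP[iF Fi] : i%:R <= M%:R * F t < i.+1%:R.
  by apply: truncn_itv; rewrite mulr_ge0//; have /andP[] := F01 t.
have iM : (i <= M)%N.
  rewrite -(ler_nat R) (le_trans iF)// -[leRHS]mulr1 ler_pM2l//.
  by have /andP[] := F01 t.
have upper (f : R -> R) : {homo f : s t / s <= t} -> (forall t, 0 <= f t <= 1) ->
    (forall i, (0 < i < M)%N -> `|f (t_ i) - i%:R / M%:R| <= delta) ->
    f t <= i.+1%:R / M%:R + delta.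
  move=> fm f01 ft; have [iM1|iM1] := ltnP i.+1 M.
    have := ft i.+1; rewrite iM1 => /(_ isT); rewrite ler_norml lerBlDl => /andP[_ h].
    apply: le_trans h; apply: fm; rewrite leNgt; apply/negP => /ltW /Fm.
    by rewrite Ft ?iM1// ler_pdivrMr// mulrC leNgt Fi.
  have /andP[_ f1] := f01 t; rewrite (le_trans f1)// (@le_trans _ _ (i.+1%:R / M%:R))//.
    by rewrite ler_pdivlMr// mul1r ler_nat.
  by rewrite lerDl.
(* The grid point used is that of i-1, not i: F may be flat, and only F (t_ (i-1)) < F t forces t_
   (i-1) < t. For i <= 1 the bound is at most 0. *)
have lower (f : R -> R) : {homo f : s t / s <= t} -> (forall t, 0 <= f t <= 1) ->
    (forall i, (0 < i < M)%N -> `|f (t_ i) - i%:R / M%:R| <= delta) ->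
    (i%:R - 1) / M%:R - delta <= f t.
  move=> fm f01 ft; case Ei : i => [|[|j]].
  - have /andP[f0 _] := f01 t; apply: le_trans f0.
    lra.
  - have /andP[f0 _] := f01 t; apply: le_trans f0.
    lra.
  - have jM : (0 < j.+1 < M)%N by rewrite /= -Ei.
    have := ft j.+1 jM; rewrite ler_norml => /andP[h _].
    rewrite -[j.+2%:R]natr1 addrK.
    apply: (@le_trans _ _ (f (t_ j.+1))); first by move: h; lra.
    apply: fm; rewrite leNgt; apply/negP => /ltW /Fm.
    rewrite Ft// ler_pdivlMr// mulrC leNgt (lt_le_trans _ iF)//.
    by rewrite Ei ltr_nat.
have e : i.+1%:R / M%:R = (i%:R - 1) / M%:R + 2 / M%:R :> R.
  by rewrite -mulrDl -natr1; congr (_ / _); lra.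
have ua := upper a am a01 at_; have ub := upper b bm b01 bt_.
have la := lower a am a01 at_; have lb := lower b bm b01 bt_.
rewrite e in ua ub; rewrite ler_norml; apply/andP; split; lra.
Qed.

End empirical.

Section empirical_random.
Context {R : realType} {disp : measure_display} {Omega : measurableType disp}
  {Pr : probability Omega R}.

Lemma ecdf_deviation (n : nat) (Y : 'I_n -> {RV Pr >-> R}) (t p delta : R) :
  (0 < n)%N -> 0 < delta ->
  (forall i, Pr (Y i @^-1` `]-oo, t]%classic) = p%:E) ->
  (forall i j, i != j -> Pr (Y i @^-1` `]-oo, t]%classic `&` Y j @^-1` `]-oo,
      t]%classic) =
    (p%:E * p%:E)%E) ->
  (Pr [set w | (delta <= `|ecdf (Y ^~ w) t - p|)%R] <= ((n%:R * delta ^+ 2)^-1)%:E)%E.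
Proof.
(* Chebyshev: by pairwise independence the variance of the sum of the
   centered indicators [Z i] is the sum of their variances, at most [n]. *)
move=> n0 d0 Yp Ypp.
have nR : 0 < n%:R :> R by rewrite ltr0n.
pose E i := Y i @^-1` `]-oo, t]%classic.
have mE i : measurable (E i) by exact: measurable_funPTI.
pose Z i (w : Omega) : R := \1_(E i) w - p.
have mZ i : measurable_fun setT (Z i) by apply: measurable_funB.
have Z1 i w : `|Z i w| <= 1 + `|p|.
  rewrite (le_trans (ler_normB _ _))// lerD2r indicE.
  by case: (_ \in _); rewrite ?normr1 ?normr0.
have ind01 A w : `|\1_A w : R| <= 1.
  by rewrite indicE; case: (_ \in _); rewrite ?normr1 ?normr0.
have iind A : measurable A -> Pr.-integrable setT (EFin \o (\1_A : Omega -> R)).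
  by move=> mA; apply: (bounded_integrable (B := 1)) => // w; exact: ind01.
have Iind A : measurable A -> \int[Pr]_w (\1_A w : R) = fine (Pr A).
  by move=> mA; rewrite /Rintegral integral_indic// setIT.
have Icst : \int[Pr]_w p = p.
  rewrite Rintegral_cst//; transitivity (p * fine (1%E : \bar R)); last by rewrite mulr1.
  by congr (_ * fine _); exact: probability_setT.
have iZZ i j : Pr.-integrable setT (EFin \o (fun w => Z i w * Z j w)).
  apply: (bounded_integrable (B := (1 + `|p|) * (1 + `|p|))); first exact:
    measurable_funM.
  by move=> w; rewrite normrM ler_pM.
have IZZ i j : \int[Pr]_w (Z i w * Z j w) = fine (Pr (E i `&` E j)) - p ^+ 2.
  under eq_Rintegral => w _.
    rewrite (_ : Z i w * Z j w = (\1_(E i `&` E j) w - p * \1_(E i) w) + (p ^+ 2 - p *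
      \1_(E j) w)); last first.
      by rewrite /Z indicI /=; ring.
    over.
  have ipE k : Pr.-integrable setT (EFin \o (fun w => p * \1_(E k) w)).
    apply: (bounded_integrable (B := `|p| * 1)) => [|w]; first exact: measurable_funM.
    by rewrite normrM ler_wpM2l.
  have ic : Pr.-integrable setT (EFin \o (fun=> p ^+ 2)) by exact:
      finite_measure_integrable_cst.
  have iEE : Pr.-integrable setT (EFin \o (\1_(E i `&` E j) : Omega -> R)).
    by apply: iind; exact: measurableI.
  have i1 := integrableB measurableT iEE (ipE i).
  have i2 := integrableB measurableT ic (ipE j).
  rewrite RintegralD// RintegralB// RintegralB// !RintegralZl ?Iind//; try (by apply:
    iind); try (by apply: measurableI).
    by rewrite Icst /E !Yp /=; ring.
  exact: finite_measure_integrable_cst.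
have Edev w : ecdf (Y ^~ w) t - p = (\sum_i Z i w) / n%:R.
  rewrite ecdf_sum sumrB sumr_const card_ord mulrBl -[p *+ n]mulr_natr mulfK ?gt_eqF//.
  congr (_ / _ - _); apply: eq_bigr => i _; rewrite indicE; congr (_%:R);
    congr nat_of_bool.
  by apply/idP/idP; rewrite inE /E /preimage/= in_itv.
pose g w := \sum_i \sum_j Z i w * Z j w.
have gE w : (ecdf (Y ^~ w) t - p) ^+ 2 = g w / n%:R ^+ 2.
  rewrite Edev exprMn exprVn; congr (_ / _); rewrite /g expr2 mulr_suml.
  by apply: eq_bigr => i _; rewrite mulr_sumr.
have ig1 i : Pr.-integrable setT (EFin \o (fun w => \sum_j Z i w * Z j w)).
  rewrite (_ : _ \o _ = fun x => (\sum_j (Z i x * Z j x)%:E)%E); last first.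
    by apply/funext => x; rewrite /= sumEFin.
  by apply: integrable_sum => // j _; exact: iZZ.
have ig : Pr.-integrable setT (EFin \o g).
  rewrite (_ : _ \o _ = fun x => (\sum_i (\sum_j Z i x * Z j x)%:E)%E); last first.
    by apply/funext => x; rewrite /= sumEFin.
  by apply: integrable_sum => // i _; exact: ig1.
have Ig : \int[Pr]_w g w <= n%:R.
  rewrite /g Rintegral_sum// (_ : n%:R = \sum_(i < n) 1);
    last by rewrite sumr_const card_ord.
  apply: ler_sum => i _; rewrite Rintegral_sum// (bigD1 i)//= big1.
    have h : fine (Pr (E i)) <= 1.
      by rewrite -lee_fin fineK ?probability_le1// fin_num_measure.
    have := sqr_ge0 p; rewrite addr0 IZZ setIid; lra.
  by move=> j ji; rewrite IZZ Ypp 1?eq_sym//= expr2 subrr.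
set D := [set w | _].
have mD : measurable D by exact: measurable_ecdf_deviation.
have main : (delta * n%:R) ^+ 2 * fine (Pr D) <= n%:R.
  apply: le_trans Ig; rewrite -Iind// -RintegralZl//; last exact: iind.
  apply: le_Rintegral => //.
    apply: (bounded_integrable (B := `|(delta * n%:R) ^+ 2| * 1)) => [|w].
      exact: measurable_funM.
    by rewrite normrM ler_wpM2l.
  move=> w _; have n2 : 0 < n%:R ^+ 2 :> R by rewrite exprn_gt0.
  have -> : g w = (ecdf (Y ^~ w) t - p) ^+ 2 * n%:R ^+ 2 by rewrite gE divfK// gt_eqF.
  rewrite indicE; have [wD|_] := boolP (w \in D); last first.
    by rewrite mulr0 mulr_ge0// sqr_ge0.
  rewrite mulr1 exprMn ler_pM2r// -[leRHS]real_normK ?num_real//.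
  by rewrite lerXn2r ?nnegrE ?(ltW d0)//; move: wD; rewrite inE.
rewrite -[leLHS]fineK ?fin_num_measure// lee_fin -[leRHS]mul1r ler_pdivlMr ?mulr_gt0
  ?exprn_gt0//.
rewrite -(ler_pM2r nR) mul1r (le_trans _ main)// le_eqVlt; apply/orP; left; apply/eqP;
  ring.
Qed.

(* Glivenko-Cantelli on the grid of the quantiles [t_ i] of order i/M. *)
Lemma KS_deviation (n1 n2 : nat) (Y : 'I_n1 -> {RV Pr >-> R}) (Z : 'I_n2 -> {RV Pr >-> R})
    (F : R -> R) (t_ : nat -> R) (M : nat) (delta : R) :
  (0 < n1)%N -> (0 < n2)%N -> (0 < M)%N -> 0 < delta ->
  {homo F : s t / s <= t} -> (forall t, 0 <= F t <= 1) ->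
  (forall i, (0 < i < M)%N -> F (t_ i) = i%:R / M%:R) ->
  (forall i t, Pr (Y i @^-1` `]-oo, t]%classic) = (F t)%:E) ->
  (forall i t, Pr (Z i @^-1` `]-oo, t]%classic) = (F t)%:E) ->
  (forall i j t, i != j -> Pr (Y i @^-1` `]-oo, t]%classic `&` Y j @^-1` `]-oo,
      t]%classic) =
    ((F t)%:E * (F t)%:E)%E) ->
  (forall i j t, i != j -> Pr (Z i @^-1` `]-oo, t]%classic `&` Z j @^-1` `]-oo,
      t]%classic) =
    ((F t)%:E * (F t)%:E)%E) ->
  (Pr [set w | (2 / M%:R + 2 * delta < two_sample_KS (Y ^~ w) (Z ^~ w))%R] <=
    (M%:R * ((n1%:R * delta ^+ 2)^-1 + (n2%:R * delta ^+ 2)^-1))%:E)%E.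
Proof.
move=> n10 n20 M0 d0 Fm F01 Ft YF ZF YYF ZZF.
pose A (n : nat) (W : 'I_n -> {RV Pr >-> R}) (i : nat) : set Omega :=
  [set w | delta <= `|ecdf (W ^~ w) (t_ i) - F (t_ i)|].
have mA n (W : 'I_n -> {RV Pr >-> R}) i : measurable (A n W i) by exact:
    measurable_ecdf_deviation.
have mU i : measurable (A n1 Y i `|` A n2 Z i) by exact: measurableU.
have sub : [set w | 2 / M%:R + 2 * delta < two_sample_KS (Y ^~ w) (Z ^~ w)] `<=`
    \big[setU/set0]_(i < M) (A n1 Y i `|` A n2 Z i).
  move=> w /=; apply: contraPP => nA; apply/negP; rewrite -leNgt.
  have nAi i : (i < M)%N -> ~ (A n1 Y i w \/ A n2 Z i w).
    move=> iM Ai; apply: nA; rewrite -(bigcup_mkord _ (fun i => A n1 Y i `|` A n2 Z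
      i)); by exists i.
  apply: two_sample_KS_le; apply: (@grid_bound _ M F _ _ t_) => //; try exact: ltW.
  - exact: ecdf_nondecreasing.
  - exact: ecdf_bounds.
  - exact: ecdf_nondecreasing.
  - exact: ecdf_bounds.
  - move=> i iM; rewrite -Ft// leNgt; apply/negP => /ltW h.
    by apply: (nAi i); [by case/andP: iM|left].
  - move=> i iM; rewrite -Ft// leNgt; apply/negP => /ltW h.
    by apply: (nAi i); [by case/andP: iM|right].
apply: (le_trans (le_measure _ _ _ sub)).
- by rewrite inE; apply: measurable_KS_gt.
- by rewrite inE; apply: bigsetU_measurable.
apply: (le_trans (@Boole_inequality _ R Omega Pr (fun i => A n1 Y i `|` A n2 Z i) M
  (fun i _ => mU i))).
rewrite (_ : _ * _ = \sum_(i < M) ((n1%:R * delta ^+ 2)^-1 + (n2%:R * delta ^+ 2)^-1));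
  last first.
  by rewrite sumr_const card_ord mulr_natl.
rewrite -sumEFin; apply: lee_sum => i _.
apply: (le_trans (measureU2 _ _ _)) => //.
by rewrite EFinD leeD//; apply: ecdf_deviation => // *; [exact: YYF|exact: ZZF].
Qed.

(** One threshold t is enough: if both empirical values are within less than delta of p and q, they
    differ by more than |p - q| - 2 delta >= c. *)
Lemma KS_separation (n1 n2 : nat) (Y : 'I_n1 -> {RV Pr >-> R}) (Z : 'I_n2 -> {RV Pr >->
    R})
    (t p q delta c : R) :
  (0 < n1)%N -> (0 < n2)%N -> 0 < delta -> c + 2 * delta <= `|p - q| ->
  (forall i, Pr (Y i @^-1` `]-oo, t]%classic) = p%:E) ->
  (forall i, Pr (Z i @^-1` `]-oo, t]%classic) = q%:E) ->
  (forall i j, i != j -> Pr (Y i @^-1` `]-oo, t]%classic `&` Y j @^-1` `]-oo,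
      t]%classic) =
    (p%:E * p%:E)%E) ->
  (forall i j, i != j -> Pr (Z i @^-1` `]-oo, t]%classic `&` Z j @^-1` `]-oo,
      t]%classic) =
    (q%:E * q%:E)%E) ->
  ((1 - ((n1%:R * delta ^+ 2)^-1 + (n2%:R * delta ^+ 2)^-1))%:E <=
   Pr [set w | (c < two_sample_KS (Y ^~ w) (Z ^~ w))%R])%E.
Proof.
move=> n10 n20 d0 cpq YF ZF YYF ZZF.
set K := [set w | _].
have mK : measurable K by apply: measurable_KS_gt.
pose A (n : nat) (W : 'I_n -> {RV Pr >-> R}) (r : R) : set Omega :=
  [set w | delta <= `|ecdf (W ^~ w) t - r|].
have mA n (W : 'I_n -> {RV Pr >-> R}) r : measurable (A n W r) by exact:
    measurable_ecdf_deviation.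
have sub : ~` K `<=` A n1 Y p `|` A n2 Z q.
  move=> w; apply: contra_notP => /not_orP[/= /negP + /negP].
  rewrite -!ltNge => h1 h2; rewrite /K/=; apply: (lt_le_trans _ (le_two_sample_KS _ _ t)).
  set a := ecdf _ t in h1 *; set b := ecdf _ t in h2 *.
  have h := ler_distD a p q; have h' := ler_distD b a q.
  rewrite distrC in h1; lra.
have : (Pr (~` K) <= ((n1%:R * delta ^+ 2)^-1 + (n2%:R * delta ^+ 2)^-1)%:E)%E.
  apply: (le_trans (le_measure _ _ _ sub)); rewrite ?inE//; [exact: measurableC|exact:
    measurableU|].
  apply: (le_trans (measureU2 _ _ _)) => //.
  by rewrite EFinD leeD//; apply: ecdf_deviation.
rewrite probability_setC// -[Pr K]fineK ?fin_num_measure// -EFinB !lee_fin; lra.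
Qed.

End empirical_random.

(** * Absolute continuity and critical values *)

(** Left continuity is right continuity of the distribution function of -x: without atoms, Q ]-oo,
    s] is 1 minus that function at -s. *)
Lemma continuous_cdf_of_atomless (R : realType) (Q : probability R R) :
  (forall t, Q [set t] = 0%E) -> continuous (fun t : R => Q `]-oo, t]%classic).
Proof.
move=> Q0 t; apply/left_right_continuousP; split; last first.
  exact: (@cdf_right_continuous _ _ _ Q (mfun_of (@measurable_id _ R setT)) t).
have mopp : measurable_fun setT (fun x : R => - x) by exact: oppr_measurable.
pose G := cdf (mfun_of mopp : {RV Q >-> R}).
have FG s : Q `]-oo, s]%classic = (1 - G (- s)%R)%E.
  have -> : G (- s) = Q `[s, +oo[%classic.
    rewrite /G /cdf /distribution /pushforward/=; congr (Q _).
    by apply/seteqP; split => x; rewrite /preimage/= !in_itv/= andbT lerN2.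
  have <- : Q `]-oo, s[%classic = Q `]-oo, s]%classic.
    have -> : `]-oo, s]%classic = `]-oo, s[%classic `|` [set s] by rewrite setUitv1.
    rewrite measureU//; first by rewrite [X in _ = (_ + X)%E](Q0 s) adde0.
    by rewrite -subset0 => x [/=]; rewrite in_itv/= => /[swap] ->; rewrite ltxx.
  by rewrite -[`]-oo, s[%classic]setCK probability_setC; [rewrite setCitvl|exact:
    measurableC].
apply/cvg_at_leftNP.
rewrite FG (_ : _ \o _ = (fun s => 1 - G s)%E); last first.
  by apply/funext => s; rewrite /= FG opprK.
have GN := @cdf_right_continuous _ _ _ Q (mfun_of mopp) (- t).
apply: (cvgeB _ (cvg_cst 1%E) GN).
by rewrite fin_num_adde_defl// fin_numN /cdf fin_num_measure.
Qed.

Section absolutely_continuous.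
Context {R : realType} {d : nat}.
Notation Rd := (borelRd R d).
Context (P : probability Rd R).
Hypothesis hac : P `<< @lebesgueRd R d.

Lemma measurable_rays (v : 'cV[R]_d) t : measurable ([set x | inner v x <= t] : set Rd).
Proof.
rewrite (_ : mkset _ = (inner v : Rd -> R) @^-1` `]-oo, t]%classic).
  by rewrite -[X in measurable X]setTI; exact: measurable_innerl.
by apply/seteqP; split => x; rewrite /preimage/= in_itv.
Qed.

Definition projection_law (v : 'cV[R]_d) : probability R R :=
  distribution P (mfun_of (measurable_innerl v)).

Lemma hyperplane_prob0 (v : 'cV[R]_d) (t : R) : v != 0 ->
  P ((inner v : Rd -> R) @^-1` [set t]) = 0%E.
Proof.
move=> v0; have mH : measurable ((inner v : Rd -> R) @^-1` [set t]).
  by rewrite -[X in measurable X]setTI; exact: measurable_innerl.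
have /hac : (@lebesgueRd R d).-null_set ((inner v : Rd -> R) @^-1` [set t]).
  by move=> B _ Bt; exact: hyperplane_null v0 Bt.
exact.
Qed.

Lemma projection_law_continuous (v : 'cV[R]_d) : v != 0 ->
  continuous (fun t : R => projection_law v `]-oo, t]%classic).
Proof. by move=> v0; apply: continuous_cdf_of_atomless => t; exact: hyperplane_prob0. Qed.

(** A vanishing moment would concentrate P at the origin, hence on a null hyperplane. Positivity is
    what allows the ratios of moments. *)
Lemma enorm_moment_gt0 (N : nat) : (0 < d)%N ->
  (forall N, (1 <= N)%N -> (abs_moment P N < +oo)%E) ->
  0 < \int[P]_x (enorm x ^+ N).
Proof.
move=> d0 Pfin; have I0 : 0 <= \int[P]_x (enorm x ^+ N).
  by apply: Rintegral_ge0 => x _; rewrite exprn_ge0 ?enorm_ge0.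
rewrite lt_neqAle I0 andbT eq_sym; apply/eqP => I1.
have /(ae_eq_integral_abs P measurableT) : measurable_fun setT (fun x :
    Rd => (enorm x ^+ N)%:E).
  by apply/measurable_EFinP; exact: measurable_enormX.
move=> [+ _].
have -> : (\int[P]_x `|(enorm x ^+ N)%:E| = \int[P]_x (enorm x ^+ N)%:E)%E.
  by apply: eq_integral => x _; rewrite gee0_abs// lee_fin exprn_ge0// enorm_ge0.
rewrite -/(abs_moment P N) (abs_moment_fin Pfin) I1 => /(_ erefl)[A [mA A0 hA]].
pose i0 : 'I_d := Ordinal d0.
pose v : 'cV[R]_d := delta_mx i0 0.
have v0 : v != 0.
  by apply/eqP => /matrixP/(_ i0 0); rewrite !mxE !eqxx => /eqP; rewrite oner_eq0.
have mH : measurable ((inner v : Rd -> R) @^-1` [set 0]).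
  by rewrite -[X in measurable X]setTI; exact: measurable_innerl.
have : (P setT <= P (A `|` (inner v : Rd -> R) @^-1` [set 0%R]))%E.
  apply: le_measure; rewrite ?inE//; first exact: measurableU.
  move=> x _; have [xA|xA] := pselect (A x); [by left|right].
  have ex : enorm x ^+ N = 0.
    apply: contrapT => xN; apply: xA; apply: hA => /= /(_ Logic.I) [].
    by move=> /= /xN.
  have x0 : enorm x = 0 by apply/eqP; move/eqP: ex; rewrite expf_eq0 => /andP[].
  apply/eqP; rewrite /= -normr_le0 (le_trans (inner_le_enorm v x))//.
  by rewrite x0 mulr0.
rewrite leNgt => /negP; apply; apply: (le_lt_trans (measureU2 _ mA mH)).
rewrite [X in (_ + X)%E](hyperplane_prob0 0 v0) [X in (X + _)%E]A0 adde0.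
by rewrite [X in (_ < X)%E]probability_setT lte01.
Qed.

End absolutely_continuous.

(** If c >= e, the fixed level a would be at most the probability of a deviation of order e, which
    tends to 0. A space with null samples is among the data because the critical value is
    constrained only through such spaces; N does not depend on it. *)
Lemma critical_value_small (R : realType) (Q : probability R R) (a e : R) :
  0 < a -> 0 < e -> continuous (fun t : R => Q `]-oo, t]%classic) ->
  exists N : nat, forall n1 n2 (c : R), (N <= n1)%N -> (N <= n2)%N ->
  KS_critical_value a n1 n2 c ->
  forall (disp : measure_display) (Omega : measurableType disp)
    (Pr : probability Omega R)
    (Y : 'I_n1 -> {RV Pr >-> R}) (Z : 'I_n2 -> {RV Pr >-> R}),
    (forall i B, measurable B -> distribution Pr (Y i) B = Q B) ->
    (forall i B, measurable B -> distribution Pr (Z i) B = Q B) ->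
    mutually_independent (join_families Y Z) -> c < e.
Proof.
move=> a0 e0 Qc.
pose F t : R := fine (Q `]-oo, t]%classic).
have QF t : Q `]-oo, t]%classic = (F t)%:E by rewrite fineK// fin_num_measure.
have Fc : continuous F.
  move=> t; apply: fine_cvg; rewrite -QF; exact: Qc.
have Fm : {homo F : s t / s <= t}.
  move=> s t st; rewrite -lee_fin -!QF; apply: le_measure; rewrite ?inE//.
  by apply: subset_itvl; rewrite bnd_simp.
have F01 t : 0 <= F t <= 1.
  by rewrite fine_ge0//= -lee_fin -QF probability_le1.
pose idRV : {RV Q >-> R} := mfun_of (@measurable_id _ R setT).
have cdfE : cdf idRV = EFin \o F by apply/funext => t; rewrite /= -QF.
(* M > 8/e gives 2/M <= e/4; with [delta] = e/8 the threshold 2/M + 2 delta is at most e/2, below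
   c. *)
pose M := (Num.truncn (8 / e)).+1.
have M0 : (0 < M)%N by [].
have MR : 0 < M%:R :> R by rewrite ltr0n.
have Me : 2 / M%:R <= e / 4.
  rewrite ler_pdivrMr// -ler_pdivrMl ?divr_gt0//.
  rewrite (_ : _ * 2 = 8 / e); last by rewrite invf_div; lra.
  by apply/ltW; rewrite /M -truncn_le_nat.
have grid i : (0 < i < M)%N -> exists t, F t = i%:R / M%:R.
  move=> /andP[i0 iM]; set v : R := i%:R / M%:R.
  have v01 : 0 < v < 1 by rewrite divr_gt0 ?ltr0n//= ltr_pdivrMr// mul1r ltr_nat.
  have /andP[v0 v1] := v01.
  have [a' Fa] : exists a', F a' < v.
    have := cvg_cdfNy0 idRV; rewrite cdfE => /fine_cvgP[_].
    move=> /cvgr_lt /(_ v v0) h.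
    by have [x Fx] := filter_ex h; exists x.
  have [b' Fb] : exists b', v < F b'.
    have := cvg_cdfy1 idRV; rewrite cdfE => /fine_cvgP[_].
    move=> /cvgr_gt /(_ v v1) h.
    by have [x Fx] := filter_ex h; exists x.
  have ab : a' <= b'.
    by rewrite leNgt; apply/negP => /ltW/Fm; rewrite leNgt (lt_trans Fa Fb).
  have [|t _ Ft] := @IVT _ F a' b' v ab (continuous_subspaceT Fc); last by exists t.
  by rewrite ge_min le_max (ltW Fa) (ltW Fb) orbT.
pose t_ i := match pselect (0 < i < M)%N with left h => projT1 (cid (grid i h)) | right
  _ => 0 end.
have Ft i : (0 < i < M)%N -> F (t_ i) = i%:R / M%:R.
  by move=> iM; rewrite /t_; case: pselect => // h; case: cid.
pose delta := e / 8.
have d0 : 0 < delta by rewrite divr_gt0.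
(* Each of the two Chebyshev terms M / (n delta^2) falls below a/2, so their sum cannot reach the
   level a. *)
pose N := (Num.truncn (2 * M%:R / (a * delta ^+ 2))).+1.
exists N => n1 n2 c n1N n2N hc disp Omega Pr Y Z YQ ZQ YZ.
rewrite ltNge; apply/negP => ec.
have K := hc _ _ _ _ _ _ Qc YQ ZQ YZ.
have iY : mutually_independent Y.
  by apply: (mutually_independent_sub (f := inl) _ YZ) => ? ? [].
have iZ : mutually_independent Z.
  by apply: (mutually_independent_sub (f := inr) _ YZ) => ? ? [].
have YF i t : Pr (Y i @^-1` `]-oo, t]%classic) = (F t)%:E by rewrite -QF -(YQ i).
have ZF i t : Pr (Z i @^-1` `]-oo, t]%classic) = (F t)%:E by rewrite -QF -(ZQ i).
have D := @KS_deviation _ _ _ Pr n1 n2 Y Z F t_ M delta (leq_trans _ n1N) (leq_trans _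
    n2N) M0 d0
   Fm F01 Ft YF ZF.
have {}D : (Pr [set w | (2 / M%:R + 2 * delta < two_sample_KS (Y ^~ w) (Z ^~ w))%R] <=
    (M%:R * ((n1%:R * delta ^+ 2)^-1 + (n2%:R * delta ^+ 2)^-1))%:E)%E.
  apply: D => // i j t ij.
    by rewrite mutually_independent_pair// !YF.
  by rewrite mutually_independent_pair// !ZF.
have : (a%:E <= (M%:R * ((n1%:R * delta ^+ 2)^-1 + (n2%:R * delta ^+ 2)^-1))%:E)%E.
  rewrite -K; apply: le_trans D; apply: le_measure; rewrite ?inE.
  - exact: measurable_KS_gt.
  - exact: measurable_KS_gt.
  - move=> w /=; apply: le_lt_trans; apply: le_trans ec; rewrite /delta; lra.
rewrite lee_fin leNgt => /negP; apply.
have key (n : nat) : (N <= n)%N -> M%:R * (n%:R * delta ^+ 2)^-1 < a / 2.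
  move=> Nn; have n0 : 0 < n%:R :> R by rewrite ltr0n (leq_trans _ Nn).
  rewrite ltr_pdivrMr ?mulr_gt0 ?exprn_gt0//.
  have : 2 * M%:R / (a * delta ^+ 2) < n%:R.
    by rewrite -truncn_lt_nat// ?divr_ge0 ?mulr_ge0 ?sqr_ge0// ltW.
  rewrite ltr_pdivrMr ?mulr_gt0 ?exprn_gt0//; lra.
have k1 := key _ n1N; have k2 := key _ n2N; lra.
Qed.

(** * Directions separating two distributions *)

Section orthogonal.
Context {R : realType} {d : nat}.
Notation Rd := (borelRd R d).

Lemma innerE (x y : 'cV[R]_d) : inner x y = (x^T *m y) 0 0.
Proof. by rewrite /inner mxE; apply: eq_bigr => i _; rewrite mxE. Qed.

Lemma enorm_orthogonal (M : 'M[R]_d) (x : 'cV[R]_d) :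
  orthogonal_mx M -> enorm (M *m x) = enorm x.
Proof.
move=> MO; rewrite /enorm !innerE trmx_mul mulmxA -(mulmxA x^T).
by rewrite (mulmx1C MO) mulmx1.
Qed.

Definition transported (P : probability Rd R) (M : 'M[R]_d) : probability Rd R :=
  distribution P (mfun_of (measurable_mulmx M)).

Lemma abs_moment_transported (P : probability Rd R) (M : 'M[R]_d) N :
  orthogonal_mx M -> abs_moment (transported P M) N = abs_moment P N.
Proof.
move=> MO; rewrite /abs_moment /transported ge0_integral_distribution.
- by apply: eq_integral => x _ /=; rewrite enorm_orthogonal.
- by apply/measurable_EFinP; exact: measurable_enormX.
- by move=> x; rewrite lee_fin exprn_ge0// enorm_ge0.
Qed.

(** The invertible matrices that preserve P form a group, and it contains the generators. *)
Lemma invariant_of_generators (P : probability Rd R) (G : set 'M[R]_d) (k : nat)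
    (T : 'I_k -> 'M[R]_d) :
  mx_group G -> mx_generated T = G ->
  (forall j B, measurable B -> transported P (T j) B = P B) -> invariant_under P G.
Proof.
move=> [Gunit _ _ _] GE TP M; rewrite -GE in Gunit *.
pose S := [set M : 'M[R]_d | M \in unitmx /\
  forall B : set Rd, measurable B -> transported P M B = P B].
have mpre (N : 'M[R]_d) (B : set Rd) : measurable B -> measurable ((mulmx N : Rd ->
    Rd) @^-1` B).
  by move=> mB; rewrite -[X in measurable X]setTI; exact: measurable_mulmx.
suff ST : mx_generated T `<=` S by move=> /ST[_ MP] B mB; exact: MP.
have Tu j : T j \in unitmx.
  by apply: Gunit; apply: (@sub_gen_smallest _ mx_group (range T)); exists j.
apply: smallest_sub; last first.
  by move=> _ [j _ <-]; split => // B; exact: TP.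
split.
- by move=> N [].
- split; first exact: unitmx1.
  by move=> B mB; congr (P _); apply/seteqP; split => x; rewrite /preimage/= mul1mx.
- move=> A B [Au AP] [Bu BP]; split; first by rewrite unitmx_mul Au.
  move=> E mE; rewrite -(AP E mE) -[RHS]BP; last exact: mpre.
  by congr (P _); apply/seteqP; split => x; rewrite /preimage/= mulmxA.
- move=> A [Au AP]; split; first by rewrite unitmx_inv.
  move=> E mE; rewrite -[LHS]AP; last exact: mpre.
  congr (P _); apply/seteqP; split => x; rewrite /preimage/=.
    by rewrite mulKmx.
  by rewrite mulKmx.
Qed.

(** * Negligible sets of directions *)

(** Homogeneity spreads the zeros over rays: the cone over A lies in the zero set of f, which is
    Lebesgue null. *)
Lemma unit_cone_null (f : 'cV[R]_d -> R) (N : nat) (A : set 'cV[R]_d) :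
  linewise_polynomial f -> (exists x, f x != 0) ->
  (forall k x, f (k *: x) = k ^+ N * f x) -> A `<=` [set x | f x = 0] ->
  uniform_sphere (A : set Rd) = 0%E.
Proof.
move=> fp f0 fh Af; rewrite /uniform_sphere.
rewrite (linewise_polynomial_zeros fp f0) ?mul0r// => x [/andP[x0 _] /Af /= fx].
by rewrite -[x](scalerKV (lt0r_neq0 x0)) fh fx mulr0.
Qed.

Lemma uniform_sphere_set0 (A : set 'cV[R]_d) : A `<=` [set 0] ->
  uniform_sphere (A : set Rd) = 0%E.
Proof.
move=> A0; rewrite /uniform_sphere.
rewrite (_ : unit_cone A = set0) ?lebesgueRd_set0 ?mul0r// -subset0.
move=> x [/andP[x0 _] /A0 /= /eqP]; rewrite scaler_eq0 invr_eq0 gt_eqF//= => /eqP xe.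
by move: x0; rewrite xe /enorm innerE mulmx0 mxE sqrtr0 ltxx.
Qed.

(** The margin [e] makes the Chebyshev bounds uniform over the directions of the set. *)
Definition separated (P Q : probability Rd R) (e : R) : set Rd :=
  [set v | exists q : rat,
    e < `|fine (P [set x | inner v x <= ratr q]) - fine (Q [set x | inner v x <=
      ratr q])|].

Lemma measurable_projected_cdf (P : probability Rd R) (t : R) :
  measurable_fun setT (fun v : Rd => P [set x | inner v x <= t]).
Proof.
pose A := [set p : Rd * Rd | inner p.1 p.2 <= t].
have mA : measurable A.
  rewrite (_ : A = (fun p : Rd * Rd => inner p.1 p.2) @^-1` `]-oo, t]%classic);
    last first.
    by apply/seteqP; split => p; rewrite /A /preimage/= in_itv.
  rewrite -[X in measurable X]setTI; apply: measurable_inner => //.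
apply: (eq_measurable_fun (P \o xsection A)); last exact: measurable_fun_xsection.
by move=> v _ /=; congr (P _); apply/seteqP; split => x; rewrite /xsection/= inE.
Qed.

Lemma measurable_separated P Q e : measurable (separated P Q e).
Proof.
rewrite (_ : separated P Q e = \bigcup_(q : rat)
  ((fun v => `|fine (P [set x | inner v x <= ratr q]) -
       fine (Q [set x | inner v x <= ratr q])|) @^-1` `]e, +oo[%classic)); last first.
  apply/seteqP; split => v.
    by move=> [q vq]; exists q => //; rewrite /preimage/= in_itv/= andbT.
  by move=> [q _]; rewrite /preimage/= in_itv/= andbT => vq; exists q.
apply: bigcupT_measurable_rat => q.
have m : measurable_fun setT (fun v : Rd => `|fine (P [set x | inner v x <= ratr q]) -
       fine (Q [set x | inner v x <= ratr q])|).
  apply: measurableT_comp => //; apply: measurable_funB;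
  by apply: measurableT_comp => //; exact: measurable_projected_cdf.
by rewrite -[X in measurable X]setTI; exact: m.
Qed.

(** A direction outside all the sets of margin 1/(n+1) has equal projections, hence is a zero of a
    nonzero homogeneous moment polynomial. The sets increase to one of full measure, and continuity
    from below yields the margin eta. *)
Lemma almost_all_directions_separate (P Q mu : probability Rd R) :
  (forall N, (1 <= N)%N -> (abs_moment P N < +oo)%E) ->
  (forall N, abs_moment Q N = abs_moment P N) ->
  (forall N, 0 < \int[P]_x (enorm x ^+ N)) ->
  (\sum_(1 <= N <oo) (abs_moment P N `^ (- N%:R^-1)%R) = +oo)%E ->
  ~ (forall B, measurable B -> P B = Q B) ->
  (forall B, measurable B -> mu B = uniform_sphere B) ->
  forall e : R, 0 < e -> exists2 eta : R, 0 < eta & ((1 - e)%:E <=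
    mu (separated P Q eta))%E.
Proof.
move=> Pfin QP mpos carl PQ muE e e0.
have QP' N : (abs_moment Q N <= abs_moment P N)%E by rewrite QP.
have Qfin N : (1 <= N)%N -> (abs_moment Q N < +oo)%E by move=> ?; rewrite QP Pfin.
have [N [h0 pN]] := moments_differ Pfin QP' mpos carl PQ.
pose f (v : 'cV[R]_d) := \int[P]_x (inner v x ^+ N) - \int[Q]_x (inner v x ^+ N).
have fh k x : f (k *: x) = k ^+ N * f x.
  have h (S : probability Rd R) : (forall N, (1 <= N)%N -> (abs_moment S N < +oo)%E) ->
      \int[S]_y (inner (k *: x) y ^+ N) = k ^+ N * \int[S]_y (inner x y ^+ N).
    move=> Sfin; rewrite -RintegralZl//.
      by apply: eq_Rintegral => y _; rewrite innerZl exprMn.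
    apply: (integrable_enorm_bound Sfin (K := sumnorm x ^+ N) (N := N));
      last by move=> y; exact: innerX_le.
    exact: (measurable_funX N (measurable_innerl x)).
  by rewrite /f !h// mulrBr.
pose E n := separated P Q n.+1%:R^-1.
have UE0 : uniform_sphere (~` \bigcup_n E n) = 0%E.
  apply: (unit_cone_null (moment_difference_linewise Pfin QP' N) _ fh);
    first by exists h0.
  move=> v vE; rewrite /= (moment_eq_of_rays N Pfin Qfin) ?subrr// => q.
  apply: contrapT => PQq; apply: vE.
  have : 0 < `|fine (P [set x | inner v x <= ratr q]) - fine (Q [set x | inner v x <=
      ratr q])|.
    rewrite normr_gt0 subr_eq0; apply/eqP => PQf; apply: PQq.
    by rewrite -[LHS]fineK ?fin_num_measure ?PQf ?fineK ?fin_num_measure//;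
      exact: measurable_rays.
  by move=> /ltr_add_invr[n]; rewrite add0r => hn; exists n => //; exists q.
have mE n : measurable (E n) by exact: measurable_separated.
have mU : measurable (\bigcup_n E n) by exact: bigcupT_measurable.
have muU : mu (\bigcup_n E n) = 1%E.
  rewrite -[X in mu X]setCK probability_setC; last exact: measurableC.
  by rewrite muE ?UE0 ?sube0//; exact: measurableC.
have : mu (E n) @[n --> \oo] --> 1%E.
  rewrite -muU; apply: nondecreasing_cvg_mu => //.
  move=> m n mn; apply/subsetPset => v [q hq]; exists q; apply: le_lt_trans hq.
  by rewrite lef_pV2 ?posrE ?ltr0n// ler_nat.
move=> /fine_cvgP[_] /cvgr_ge /(_ (1 - e)) h.
have [|n En] := filter_ex (h _); first by rewrite ltrBlDr ltrDl.
exists n.+1%:R^-1; first by rewrite invr_gt0.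
have fin : mu (E n) \is a fin_num by exact: fin_num_measure.
by rewrite -(fineK fin) lee_fin.
Qed.

End orthogonal.

(** * The test *)

Section experiment.
Context {R : realType} {d k n1 n2 : nat} {P : probability (borelRd R d) R}
  {disp : measure_display} {Omega : measurableType disp} {Pr : probability Omega R}
  {X : 'I_n1 -> {RV Pr >-> borelRd R d}} {X' : 'I_n2 -> {RV Pr >-> borelRd R d}}
  {h : 'I_k -> {RV Pr >-> borelRd R d}}.
Notation Rd := (borelRd R d).
Hypothesis exp : KS_experiment P X X' h.

Definition projected (v : 'cV[R]_d) (W : {RV Pr >-> Rd}) : {RV Pr >-> R} :=
  mfun_of (measurableT_comp (measurable_innerl v) (measurable_funPT W)).

Definition transported_RV (M : 'M[R]_d) (W : {RV Pr >-> Rd}) : {RV Pr >-> Rd} :=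
  mfun_of (measurableT_comp (measurable_mulmx M) (measurable_funPT W)).

Definition KS_event (v : 'cV[R]_d) (M : 'M[R]_d) (c : R) : set Omega :=
  [set w | c < projected_KS v M (X ^~ w) (X' ^~ w)].

Definition random_KS_event (j : 'I_k) (M : 'M[R]_d) (c : R) : set Omega :=
  [set w | c < projected_KS (h j w) M (X ^~ w) (X' ^~ w)].

Lemma measurable_random_KS_event j M c : measurable (random_KS_event j M c).
Proof.
apply: (measurable_KS_gt (f := fun i w => inner (h j w) (X i w))
  (g := fun i w => inner (h j w) (M *m X' i w))) => i.
  by apply: measurable_inner.
apply: measurable_inner => //; exact: (measurable_funPT (transported_RV M (X' i))).
Qed.

Let S := join_families X X'.

Lemma measurable_KS_section M c :
  measurable [set p : Rd * sub_space S |
    c < projected_KS p.1 M (fun i => X i p.2) (fun i => X' i p.2)].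
Proof.
have mS s := @measurable_sub_space_snd _ _ _ _ _ _ _ S _ Rd s.
apply: (measurable_KS_gt (f := fun i (p : Rd * sub_space S) => inner p.1 (X i p.2))
  (g := fun i (p : Rd * sub_space S) => inner p.1 (M *m X' i p.2))) => i.
  by apply: measurable_inner => //; exact: (mS (inl i)).
apply: measurable_inner => //.
exact: (measurableT_comp (measurable_mulmx M) (mS (inr i))).
Qed.

Lemma random_KS_event_integral j M c :
  (Pr (random_KS_event j M c) = \int[distribution Pr (h j)]_v Pr (KS_event v M c))%E.
Proof.
case: exp => _ _ _ ind.
apply: (independent_fubini (S := S) (D := [set p : Rd * sub_space S |
    c < projected_KS p.1 M (fun i => X i p.2) (fun i => X' i p.2)])).
  by move=> A B mA mB; exact: mutually_independent_block ind mA mB.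
exact: measurable_KS_section.
Qed.

Lemma measurable_KS_probability M c :
  measurable_fun setT (fun v : Rd => Pr (KS_event v M c)).
Proof. exact: (measurable_section (measurable_KS_section M c)). Qed.

Lemma samples_independent : mutually_independent S.
Proof.
case: exp => _ _ _ ind.
by apply: (mutually_independent_sub (f := inl) _ ind) => ? ? [].
Qed.

Lemma projected_samples_independent v M :
  mutually_independent (join_families (fun i => projected v (X i))
    (fun i => projected v (transported_RV M (X' i)))).
Proof.
pose phi (s : 'I_n1 + 'I_n2) : Rd -> R :=
  if s is inl _ then inner v else inner v \o mulmx M.
apply: (mutually_independent_map (phi := phi) _ _ samples_independent).
  move=> [i|i]; first exact: measurable_innerl.
  exact: (measurableT_comp (measurable_innerl v) (measurable_mulmx M)).
by move=> [i|i] w.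
Qed.

Lemma projected_sample1_law v i B : measurable B ->
  distribution Pr (projected v (X i)) B = projection_law P v B.
Proof.
move=> mB; case: exp => XP _ _ _.
have mvB : measurable ((inner v : Rd -> R) @^-1` B).
  by rewrite -[X in measurable X]setTI; exact: measurable_innerl.
exact: (XP i _ mvB).
Qed.

Lemma projected_sample2_law v M i B : measurable B ->
  distribution Pr (projected v (transported_RV M (X' i))) B =
  projection_law (transported P M) v B.
Proof.
move=> mB; case: exp => _ XP _ _.
have mvB : measurable ((inner v \o mulmx M : Rd -> R) @^-1` B).
  rewrite -[X in measurable X]setTI.
  exact: (measurableT_comp (measurable_innerl v) (measurable_mulmx M)).
exact: (XP i _ mvB).
Qed.

Lemma KS_event_null v M c a : v != 0 -> P `<< @lebesgueRd R d ->
  (forall B, measurable B -> transported P M B = P B) ->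
  KS_critical_value a n1 n2 c -> Pr (KS_event v M c) = a%:E.
Proof.
move=> v0 hac MP hc.
apply: (hc _ _ Pr (projection_law P v) (fun i => projected v (X i))
    (fun i => projected v (transported_RV M (X' i)))).
- exact: projection_law_continuous.
- by move=> i B; exact: projected_sample1_law.
- move=> i B mB; rewrite projected_sample2_law//.
  by apply: MP; rewrite -[X in measurable X]setTI; exact: measurable_innerl.
- exact: projected_samples_independent.
Qed.

Lemma random_KS_event_null j M c a : P `<< @lebesgueRd R d ->
  (forall B, measurable B -> transported P M B = P B) ->
  KS_critical_value a n1 n2 c -> Pr (random_KS_event j M c) = a%:E.
Proof.
move=> hac MP hc; rewrite random_KS_event_integral.
pose Z := (enorm : Rd -> R) @^-1` [set 0].
have mZ : measurable Z by rewrite -[X in measurable X]setTI; exact: measurable_enorm.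
have Z0 : Z `<=` [set 0].
  move=> x x0; apply/colP => i; rewrite mxE; apply/eqP.
  have := inner_le_enorm (delta_mx i 0) x; rewrite x0 mulr0 normr_le0.
  rewrite /inner (bigD1 i)//= big1 => [|l li]; last by rewrite mxE (negbTE li) mul0r.
  by rewrite mxE !eqxx mul1r addr0.
have muZ : distribution Pr (h j) Z = 0%E.
  by case: exp => _ _ hU _; rewrite hU//; exact: uniform_sphere_set0.
rewrite (ae_eq_integral (cst a%:E))//; last 2 first.
- exact: measurable_KS_probability.
- exists Z; split => // v /= /not_implyP[_ va].
  apply: contrapT => vZ; apply: va; apply: KS_event_null => //.
  apply: contra_notN vZ => /eqP ->.
  by rewrite /Z /preimage/= /enorm innerE mulmx0 mxE sqrtr0.
rewrite integral_cst// [X in (_ * X)%E]probability_setT mule1//.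
Qed.

(** The integral over directions is restricted to the separated set, where 1 - r bounds the
    integrand from below. Taking delta = eta/4 and c <= eta/2 gives c + 2 delta <= eta, which is
    below the gap. *)
Lemma random_KS_event_lower j M c eta r :
  (0 < n1)%N -> (0 < n2)%N -> 0 < eta -> c <= eta / 2 ->
  (n1%:R * (eta / 4) ^+ 2)^-1 + (n2%:R * (eta / 4) ^+ 2)^-1 <= r -> r <= 1 ->
  ((1 - r)%:E * distribution Pr (h j) (separated P (transported P M) eta) <=
    Pr (random_KS_event j M c))%E.
Proof.
move=> n10 n20 eta0 ceta rle r1; rewrite random_KS_event_integral.
set E := separated P _ eta; have mE : measurable E by exact: measurable_separated.
rewrite -[X in distribution Pr (h j) X]setIT -integral_indic// -ge0_integralZl//;
  last 2 first.
- exact/measurable_EFinP.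
- by rewrite lee_fin subr_ge0.
apply: ge0_le_integral => //.
- by move=> v _; rewrite mule_ge0// lee_fin ?subr_ge0.
- by apply: measurable_funeM; apply/measurable_EFinP.
- exact: measurable_KS_probability.
move=> v _; rewrite indicE; have [vE|_] := boolP (v \in E); last by rewrite mule0.
rewrite mule1; move: vE; rewrite inE => -[q pq].
have d0 : 0 < eta / 4 by rewrite divr_gt0.
set p := fine _ in pq; set p' := fine _ in pq.
have pE : P [set x | inner v x <= ratr q] = p%:E.
  by rewrite fineK// fin_num_measure//; exact: measurable_rays.
have pE' : transported P M [set x | inner v x <= ratr q] = p'%:E.
  by rewrite fineK// fin_num_measure//; exact: measurable_rays.
have rayE (Q : probability Rd R) : projection_law Q v `]-oo, ratr q]%classic =
    Q [set x | inner v x <= ratr q].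
  by congr (Q _); apply/seteqP; split => x; rewrite /preimage/= in_itv.
have Yp i : Pr (projected v (X i) @^-1` `]-oo, ratr q]%classic) = p%:E.
  by rewrite -pE -rayE -(projected_sample1_law v i).
have Zp i : Pr (projected v (transported_RV M (X' i)) @^-1` `]-oo, ratr q]%classic) =
    p'%:E.
  by rewrite -pE' -rayE -(projected_sample2_law v M i).
have ind := projected_samples_independent v M.
have iY : mutually_independent (fun i => projected v (X i)).
  by apply: (mutually_independent_sub (f := inl) _ ind) => ? ? [].
have iZ : mutually_independent (fun i => projected v (transported_RV M (X' i))).
  by apply: (mutually_independent_sub (f := inr) _ ind) => ? ? [].
apply: (@le_trans _ _ (1 - ((n1%:R * (eta / 4) ^+ 2)^-1 + (n2%:R * (eta / 4) ^+
  2)^-1))%:E).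
  by rewrite lee_fin lerD2l lerN2.
apply: (@KS_separation _ _ _ Pr n1 n2 (fun i => projected v (X i))
   (fun i => projected v (transported_RV M (X' i))) (ratr q) p p') => //.
- by apply: le_trans (ltW pq); lra.
- by move=> i l il; rewrite (mutually_independent_pair iY)// !Yp.
- by move=> i l il; rewrite (mutually_independent_pair iZ)// !Zp.
Qed.

End experiment.

Theorem theorem4p1 (R : realType) (d : nat) (hd : (2 <= d)%N)
    (P : probability (borelRd R d) R)
    (G : set 'M[R]_d) (k : nat) (T : 'I_k -> 'M[R]_d) (alpha : R)
    (hGgroup : mx_group G) (hGfin : finite_set G)
    (hGorth : forall M, G M -> orthogonal_mx M) (hGgen : mx_generated T = G)
    (halpha : 0 < alpha < k%:R^-1)
    (hmom : forall N, (1 <= N)%N -> (abs_moment P N < +oo)%E)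
    (hcarleman :
      (\sum_(1 <= N <oo) (abs_moment P N `^ (- N%:R^-1)%R) = +oo)%E)
    (hac : P `<< @lebesgueRd R d)
    (* the pairs (n1, n2) of sample sizes under consideration *)
    (sizes : set (nat * nat))
    (hsizes : forall n, sizes n -> (0 < n.1)%N /\ (0 < n.2)%N)
    (c : nat * nat -> R)
    (hc : forall n, sizes n ->
      KS_critical_value (alpha / k%:R) n.1 n.2 (c n))
    (disp : nat * nat -> measure_display)
    (Omega : forall n, measurableType (disp n))
    (Pr : forall n, probability (Omega n) R)
    (X : forall n, 'I_n.1 -> {RV (Pr n) >-> borelRd R d})
    (X' : forall n, 'I_n.2 -> {RV (Pr n) >-> borelRd R d})
    (h : forall n, 'I_k -> {RV (Pr n) >-> borelRd R d})
    (hexp : forall n, sizes n -> KS_experiment P (X n) (X' n) (h n)) :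
  (invariant_under P G -> forall n, sizes n ->
    ((alpha / k%:R)%:E <= Pr n (KS_rejection T (c n) (X n) (X' n) (h n))
       <= alpha%:E)%E) /\
  (~ invariant_under P G ->
    Pr n (KS_rejection T (c n) (X n) (X' n) (h n))
      @[n --> within sizes (filter_prod \oo \oo)] --> 1%E).
Proof.
have /andP[alpha0 alphak] := halpha.
have k0 : (0 < k)%N.
  rewrite lt0n; apply/eqP => k0; move: (lt_trans alpha0 alphak).
  by rewrite k0 invr0 ltxx.
have kR : 0 < k%:R :> R by rewrite ltr0n.
have TG j : G (T j) by rewrite -hGgen; apply: (@sub_gen_smallest _ mx_group (range T));
    exists j.
(* Indexing by naturals, with empty sets from k on, fits the form of Boole's inequality. *)
pose A n (i : nat) : set (Omega n) := [set w | exists2 j : 'I_k, val j = i &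
  c n < projected_KS (h n j w) (T j) (X n ^~ w) (X' n ^~ w)].
have AE n (j : 'I_k) : A n j = random_KS_event (X := X n) (X' := X' n) (h :=
    h n) j (T j) (c n).
  by apply/seteqP; split => [w [l /val_inj ->]|w wj] //; exists j.
have mA n i : (i < k)%N -> measurable (A n i).
  by move=> ik; rewrite (AE n (Ordinal ik)); exact: measurable_random_KS_event.
have RE n : KS_rejection T (c n) (X n) (X' n) (h n) = \big[setU/set0]_(i < k) A n i.
  rewrite -(bigcup_mkord _ (A n)); apply/seteqP; split => w.
    by move=> [j wj]; exists (val j) => //=; exists j.
  by move=> [i _ [j _ wj]]; exists j.
have mR n : measurable (KS_rejection T (c n) (X n) (X' n) (h n)).
  by rewrite RE; apply: bigsetU_measurable => i _; exact: mA.
have sub n (j : 'I_k) : A n j `<=` KS_rejection T (c n) (X n) (X' n) (h n).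
  by move=> w; rewrite AE => wj; exists j.
split.
  move=> inv n sn.
  have PA (j : 'I_k) : Pr n (A n j) = (alpha / k%:R)%:E.
    rewrite AE; apply: (random_KS_event_null (hexp _ sn)) => //; last exact: hc.
    by move=> B mB; exact: inv.
  apply/andP; split.
    rewrite -(PA (Ordinal k0)); apply: le_measure; rewrite ?inE//; last exact: sub.
    exact: mA.
  rewrite RE; apply: (le_trans (@Boole_inequality _ R (Omega n) (Pr n) (A n) k (mA n))).
  rewrite (eq_bigr (fun=> (alpha / k%:R)%:E)); last by move=> i _; exact: PA.
  rewrite sumEFin sumr_const card_ord lee_fin -[leLHS]mulr_natr divfK// gt_eqF//.
move=> ninv.
have [j PTj] : exists j, ~ (forall B, measurable B -> transported P (T j) B = P B).
  apply: contrapT => hj; apply: ninv; apply: (invariant_of_generators hGgroup hGgen) => j.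
  by apply: contrapT => nj; apply: hj; exists j.
have d0 : (0 < d)%N by exact: leq_trans hd.
have mpos N : 0 < \int[P]_x (enorm x ^+ N) by exact: enorm_moment_gt0.
pose v0 : 'cV[R]_d := delta_mx (Ordinal d0) 0.
have v00 : v0 != 0.
  by apply/eqP => /matrixP/(_ (Ordinal d0) 0); rewrite !mxE !eqxx => /eqP;
    rewrite oner_eq0.
have lower e : 0 < e -> e < 1 -> exists N, forall n, sizes n -> (N <= n.1)%N -> (N <=
    n.2)%N ->
    1 - e <= fine (Pr n (KS_rejection T (c n) (X n) (X' n) (h n))).
  (* [uniform_sphere] is treated as a probability only as the law of an actual direction, so one
     pair of sizes is fixed. The margin eta drawn from it then serves all sizes. *)
  move=> e0 e1; have [[n0 sn0]|nos] := pselect (exists n, sizes n); last first.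
    by exists 0%N => n sn; exfalso; apply: nos; exists n.
  have e20 : 0 < e / 2 by rewrite divr_gt0.
  have [_ _ hU _] := hexp _ sn0.
  have [eta eta0 sepU] : exists2 eta : R, 0 < eta &
      ((1 - e / 2)%:E <= uniform_sphere (separated P (transported P (T j)) eta))%E.
    have [|eta eta0 sep] := almost_all_directions_separate hmom
      (fun N => abs_moment_transported P N (hGorth _ (TG j))) mpos hcarleman _ (hU j) e20.
      by move=> PQ; apply: PTj => B mB; rewrite PQ.
    by exists eta => //; rewrite -(hU j)//; exact: measurable_separated.
  have [N1 N1P] := critical_value_small (divr_gt0 alpha0 kR) (divr_gt0 eta0 (ltr0Sn R 1))
    (projection_law_continuous hac v00).
  pose delta := eta / 4; have delta0 : 0 < delta by rewrite divr_gt0.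
  pose N2 := (Num.truncn (4 / (e * delta ^+ 2))).+1.
  exists (maxn N1 N2) => n sn; rewrite !geq_max => /andP[n11 n12] /andP[n21 n22].
  have [n10 n20] := hsizes n sn.
  have key (m : nat) : (N2 <= m)%N -> (m%:R * delta ^+ 2)^-1 <= e / 4.
    move=> Nm; have m0 : 0 < m%:R :> R by rewrite ltr0n (leq_trans _ Nm).
    rewrite invf_ple ?posrE ?mulr_gt0 ?exprn_gt0// ?divr_gt0// invf_div.
    have : 4 / (e * delta ^+ 2) < m%:R.
      by rewrite -truncn_lt_nat// ?divr_ge0 ?mulr_ge0 ?sqr_ge0// ltW.
    rewrite ltr_pdivrMr ?mulr_gt0 ?exprn_gt0// => hm.
    rewrite ler_pdivrMr//; lra.
  (* Although H0 fails, the untransported samples (matrix 1) projected on [v0] are null samples with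
     a continuous law, and they constrain the same critical value. *)
  have cn : c n < eta / 2.
    apply: (N1P _ _ _ n11 n21 (hc n sn) _ _ (Pr n) (fun i => projected v0 (X n i))
      (fun i => projected v0 (transported_RV 1%:M (X' n i)))).
    - by move=> i B; exact: (projected_sample1_law (hexp _ sn)).
    - move=> i B mB; rewrite (projected_sample2_law (hexp _ sn))//.
      by congr (P _); apply/seteqP; split => x; rewrite /preimage/= mul1mx.
    - exact: (projected_samples_independent (hexp _ sn)).
  have r1 : e / 2 <= 1 by lra.
  have L := random_KS_event_lower (hexp _ sn) j (T j) n10 n20 eta0 (ltW cn) _ r1.
  have {}L := L (le_trans (lerD (key _ n12) (key _ n22)) _).
  have mur : (distribution (Pr n) (h n j) (separated P (transported P (T j)) eta) =
      uniform_sphere (separated P (transported P (T j)) eta))%E.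
    by have [_ _ hUn _] := hexp _ sn; rewrite hUn//; exact: measurable_separated.
  rewrite -lee_fin fineK ?fin_num_measure//.
  apply: (@le_trans _ _ (Pr n (A n j))); last first.
    by apply: le_measure; rewrite ?inE//; [exact: mA|exact: sub].
  rewrite AE; apply: le_trans (L _); last by lra.
  (* One factor 1 - e/2 comes from the two Chebyshev terms, each at most e/4, the other from the
     separated directions; their product is at least 1 - e. *)
  rewrite mur; apply: (@le_trans _ _ ((1 - e / 2)%:E * (1 - e / 2)%:E)%E).
    by rewrite -EFinM lee_fin; nra.
  by apply: lee_wpmul2l => //; rewrite lee_fin subr_ge0.
apply/fine_cvgP; split; first by apply: nearW => n;
  exact: (fin_num_measure (Pr n) _ (mR n)).
apply/cvgrPdist_le => e e0.
pose e' := Num.min e 2^-1.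
have e'0 : 0 < e' by rewrite lt_min e0 invr_gt0 ltr0n.
have e'1 : e' < 1 by rewrite gt_min invf_lt1 ?ltr1n// orbT.
have [N NP] := lower e' e'0 e'1.
rewrite near_withinE; exists ([set n | (N <= n)%N], [set n | (N <= n)%N]) => /=.
  by split; exists N.
move=> n /= [Nn1 Nn2] sn.
have L := NP n sn Nn1 Nn2.
have U : fine (Pr n (KS_rejection T (c n) (X n) (X' n) (h n))) <= 1.
  by rewrite -lee_fin fineK ?fin_num_measure// probability_le1.
rewrite ger0_norm ?subr_ge0//.
have : e' <= e by rewrite ge_min lexx.
lra.
Qed.
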